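(* Let the immersion $F:M\to\mathbb R^{1,3}$ of an oriented Riemannian surface $M$ be given by a spinor field $\varphi\in\Gamma(\Sigma E\otimes\Sigma M)$ with $D\varphi=\vec H\cdot\varphi$ and $H(\varphi,\varphi)=1$, and let $G:M\to\mathcal Q$ be its Gauss map. Then $$G^*\omega_{\mathcal Q}=(K+iK_N)\,\omega_M,$$ where $\omega_M$ is the area form of $M$. In particular, $K=K_N=0$ at $x_o\in M$ if and only if the linear space $dG_{x_o}(T_{x_o}M)$ belongs to some complex line in $T_{G(x_o)}\mathcal Q$.
   Context: Complex quaternions: $\mathbb{H}^{\mathbb{C}}=\{q_0\mathbf 1+q_1I+q_2J+q_3K:\ q_j\in\mathbb{C}\}$ is the $\mathbb C$-algebra with unit $\mathbf 1$ and $I^2=J^2=K^2=-\mathbf 1$, $IJ=-JI=K$. For $q=q_0\mathbf 1+q_1I+q_2J+q_3K$ put $\overline q=q_0\mathbf 1-q_1I-q_2J-q_3K$ and $\hat q=\overline{q_0}\mathbf 1+\overline{q_1}I+\overline{q_2}J+\overline{q_3}K$ (complex conjugation of the coefficients), and let $H(q,q')=q_0q_0'+q_1q_1'+q_2q_2'+q_3q_3'\in\mathbb C$, $\langle q,q'\rangle=\mathrm{Re}\,H(q,q')$. Minkowski space $\mathbb{R}^{1,3}$ (metric $-dx_0^2+dx_1^2+dx_2^2+dx_3^2$) is identified with $\{\xi\in\mathbb H^{\mathbb C}:\xi=-\hat{\overline\xi}\}$ via $(x_0,x_1,x_2,x_3)\mapsto ix_0\mathbf 1+x_1I+x_2J+x_3K$,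 the metric being the restriction of $H$. $Spin(1,3)=\{q\in\mathbb H^{\mathbb C}: H(q,q)=1\}$, acting on $\mathbb R^{1,3}$ by $\xi\mapsto q\xi\hat q^{-1}$. Twisted spinor bundle: $(M,g)$ is an oriented Riemannian surface and $E\to M$ a rank $2$ real vector bundle with a metric of signature $(1,1)$ on the fibers, a compatible connection and an orientation in space and in time; spin structures $\tilde Q_1\to Q_1$, $\tilde Q_2\to Q_2$ are given on $E$ and $TM$, where $Q_1,Q_2$ are the bundles of positively oriented orthonormal frames $(e_0,e_1)$ of $E$ ($\langle e_0,e_0\rangle=-1$, $e_0$ future-directed, $\langle e_1,e_1\rangle=1$) and $(e_2,e_3)$ of $TM$. Let $Spin(1,1)=\{\pm(\cosh t\,\mathbf 1+i\sinh t\,I):t\in\mathbb R\}$, $Spin(2)=\{\cos\theta\,\mathbf 1+\sin\theta\, I:\theta\in\mathbb R\}$ (subgroups of $Spin(1,3)$) and $\tilde Q=\tilde Q_1\times_M\tilde Q_2$. Then $\Sigma=\Sigma E\otimes\Sigma M$ is the bundle associated with $\tilde Q$ and the representation of $Spin(1,1)\times Spin(2)$ on $\mathbb H^{\mathbb C}$ by left multiplication $(g_1,g_2)\mapsto(\xi\mapsto g_1g_2\xi)$, with the connection $\nabla$ induced by the connection of $E$ and the Levi-Civita connection of $M$. In a local section $\tilde s$ of $\tilde Q$ lying over a frame $(e_0,e_1,e_2,e_3)$, a spinor $\varphi$ has a coordinate $[\varphi]\in\mathbb H^{\mathbb C}$, a vector $X=\sum_j x_je_j\in E\oplus TM$ has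 coordinate $[X]=ix_0\mathbf 1+x_1I+x_2J+x_3K$, and the Clifford product is $[X\cdot\varphi]=[X]\widehat{[\varphi]}$. On $\Sigma$ one sets $H(\psi,\psi')=H([\psi],[\psi'])$, $\langle\langle\psi,\psi'\rangle\rangle=\overline{[\psi']}[\psi]$ (independent of $\tilde s$). $D\varphi=e_2\cdot\nabla_{e_2}\varphi+e_3\cdot\nabla_{e_3}\varphi$; $\vec H\in\Gamma(E)$ is given. Immersion given by $\varphi$: $F:M\to\mathbb R^{1,3}$ is the isometric immersion with $dF(X)=\xi(X):=\langle\langle X\cdot\varphi,\varphi\rangle\rangle$ for $X\in TM$; the same formula $\xi$ on $E$ identifies $E$ (with metric and connection) with the normal bundle of $F$. $K$ is the Gauss curvature of $M$ and $K_N=\langle R^E(e_2,e_3)e_0,e_1\rangle$ the curvature of $E$, with $R^E(X,Y)=\nabla_X\nabla_Y-\nabla_Y\nabla_X-\nabla_{[X,Y]}$. Gauss map: $\Lambda^2\mathbb R^{1,3}$ is identified with $\mathrm{Im}\,\mathbb H^{\mathbb C}=\mathbb CI\oplus\mathbb CJ\oplus\mathbb CK$ by the linear map $v\wedge w\mapsto\frac12(v\hat w-w\hat v)$ (equal to $v\hat w$ if $v\perp w$). The Grassmannian of oriented spacelike $2$-planes is identified with $\mathcal Q=\{Z\in\mathrm{Im}\,\mathbb H^{\mathbb C}:H(Z,Z)=1\}$, and $G(x)=v_1\wedge v_2\in\mathcal Q$ for $(v_1,v_2)$ a positively oriented orthonormal basis of $dF(T_xM)$. For $\xi,\xi'\in\mathrm{Im}\,\mathbb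 H^{\mathbb C}$, $\xi\times\xi'=\frac12(\xi\xi'-\xi'\xi)$, and the complex area form of $\mathcal Q$ is $(\omega_{\mathcal Q})_p(\xi,\xi')=H(\xi\times\xi',p)$ for $p\in\mathcal Q$, $\xi,\xi'\in T_p\mathcal Q$. *)

(* Defs.v *)
From mathcomp Require Import all_boot all_order all_algebra.
From mathcomp Require Import all_classical all_reals all_analysis.
From mathcomp Require Import complex.

Set Implicit Arguments.
Unset Strict Implicit.
Unset Printing Implicit Defensive.

Import Order.TTheory GRing.Theory Num.Theory.
Import numFieldNormedType.Exports.

Local Open Scope classical_set_scope.
Local Open Scope ring_scope.
Local Open Scope complex_scope.

(** * Complex quaternions *)


Definition mkq {R : realType} (a b c d : R[i]) : 'rV[R[i]]_4 :=
  \row_(j < 4) nth 0 [:: a; b; c; d] j.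

Definition q0 {R : realType} (q : 'rV[R[i]]_4) : R[i] := q 0 (inord 0).
Definition q1 {R : realType} (q : 'rV[R[i]]_4) : R[i] := q 0 (inord 1).
Definition q2 {R : realType} (q : 'rV[R[i]]_4) : R[i] := q 0 (inord 2).
Definition q3 {R : realType} (q : 'rV[R[i]]_4) : R[i] := q 0 (inord 3).

Definition qone {R : realType} : 'rV[R[i]]_4 := mkq 1 0 0 0.
Definition qI {R : realType} : 'rV[R[i]]_4 := mkq 0 1 0 0.
Definition qJ {R : realType} : 'rV[R[i]]_4 := mkq 0 0 1 0.
Definition qK {R : realType} : 'rV[R[i]]_4 := mkq 0 0 0 1.

Definition qmul {R : realType} (p q : 'rV[R[i]]_4) : 'rV[R[i]]_4 :=
  mkq (q0 p * q0 q - q1 p * q1 q - q2 p * q2 q - q3 p * q3 q)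
      (q0 p * q1 q + q1 p * q0 q + q2 p * q3 q - q3 p * q2 q)
      (q0 p * q2 q - q1 p * q3 q + q2 p * q0 q + q3 p * q1 q)
      (q0 p * q3 q + q1 p * q2 q - q2 p * q1 q + q3 p * q0 q).

Declare Scope cquat_scope.
Delimit Scope cquat_scope with CQ.
Notation "p ** q" := (qmul p q) (at level 40, left associativity) : cquat_scope.
Local Open Scope cquat_scope.

Definition qbar {R : realType} (q : 'rV[R[i]]_4) : 'rV[R[i]]_4 :=
  mkq (q0 q) (- q1 q) (- q2 q) (- q3 q).

Definition qhat {R : realType} (q : 'rV[R[i]]_4) : 'rV[R[i]]_4 :=
  mkq (conjc (q0 q)) (conjc (q1 q)) (conjc (q2 q)) (conjc (q3 q)).

Definition qH {R : realType} (p q : 'rV[R[i]]_4) : R[i] :=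
  q0 p * q0 q + q1 p * q1 q + q2 p * q2 q + q3 p * q3 q.

(* Since q ** qbar q = qH q q *: qone, this is the inverse of every q with
   qH q q != 0. *)
Definition qinv {R : realType} (q : 'rV[R[i]]_4) : 'rV[R[i]]_4 :=
  (qH q q)^-1 *: qbar q.

Definition minkowski {R : realType} : set 'rV[R[i]]_4 :=
  [set xi | xi = - qhat (qbar xi)].

Definition mink {R : realType} (x0 x1 x2 x3 : R) : 'rV[R[i]]_4 :=
  mkq ('i * x0%:C) x1%:C x2%:C x3%:C.

Definition cosh {R : realType} (t : R) : R := (expR t + expR (- t)) / 2.
Definition sinh {R : realType} (t : R) : R := (expR t - expR (- t)) / 2.

Definition Spin11 {R : realType} : set 'rV[R[i]]_4 :=
  [set q | exists t : R,
     q = mkq (cosh t)%:C ('i * (sinh t)%:C) 0 0 \/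
     q = - mkq (cosh t)%:C ('i * (sinh t)%:C) 0 0].

Definition Spin2 {R : realType} : set 'rV[R[i]]_4 :=
  [set q | exists t : R, q = mkq (cos t)%:C (sin t)%:C 0 0].

(* v /\ w in Im H^C. *)
Definition wedge {R : realType} (v w : 'rV[R[i]]_4) : 'rV[R[i]]_4 :=
  2^-1 *: (v ** qhat w - w ** qhat v).

Definition qcross {R : realType} (v w : 'rV[R[i]]_4) : 'rV[R[i]]_4 :=
  2^-1 *: (v ** w - w ** v).

(* T_p Q for the quadric Q = {Z in Im H^C : H(Z,Z) = 1}. *)
Definition tangentQ {R : realType} (p : 'rV[R[i]]_4) : set 'rV[R[i]]_4 :=
  [set Z | q0 Z = 0 /\ qH Z p = 0].

Definition omegaQ {R : realType} (p v w : 'rV[R[i]]_4) : R[i] :=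
  qH (qcross v w) p.

(** * Oriented surfaces *)

(* f is infinitely differentiable at the points of U (used for U open). *)
Fixpoint diff_times {R : realType} (n : nat) (U : set 'rV[R]_2)
    (f : 'rV[R]_2 -> R^o) : Prop :=
  (forall p, U p -> differentiable f p) /\
  (if n is m.+1 then forall v, diff_times m U ('D_v f) else True).

Definition smooth_on {R : realType} (U : set 'rV[R]_2) (f : 'rV[R]_2 -> R) :=
  forall n, diff_times n U f.

(* cmap and cinv are total functions, only meaningful on cdom and on its
   image respectively. *)
Record chart (R : realType) (M : topologicalType) := Chart {
  cdom : set M;
  cmap : M -> 'rV[R]_2;
  cinv : 'rV[R]_2 -> M;
  cdom_open : open cdom;
  cimg_open : open (cmap @` cdom);
  cmapK : forall x, cdom x -> cinv (cmap x) = x;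
  cmap_cts : forall x, cdom x -> {for x, continuous cmap};
  cinv_cts : forall p, (cmap @` cdom) p -> {for p, continuous cinv} }.

Definition transition {R : realType} {M : topologicalType} (c d : chart R M)
    (i : 'I_2) (p : 'rV[R]_2) : R :=
  cmap d (cinv c p) 0 i.

Definition stdv {R : realType} (i : 'I_2) : 'rV[R]_2 := delta_mx 0 i.

(* The orientation is the one carried by an atlas whose transition maps have
   positive Jacobian; chart_at selects a chart around each point. *)
Record oriented_surface (R : realType) := OrientedSurface {
  points :> topologicalType;
  surf_hausdorff : hausdorff_space points;
  surf_countable : @second_countable points;
  atlas : set (chart R points);
  chart_at : points -> chart R points;
  chart_at_atlas : forall x, atlas (chart_at x);
  chart_at_dom : forall x, cdom (chart_at x) x;
  atlas_smooth : forall c d, atlas c -> atlas d -> forall i : 'I_2,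
    smooth_on (cmap c @` (cdom c `&` cdom d)) (transition c d i);
  atlas_oriented : forall c d, atlas c -> atlas d ->
    forall p, (cmap c @` (cdom c `&` cdom d)) p ->
    0 < \det (\matrix_(i < 2, j < 2)
               'D_(stdv i) (transition c d j : 'rV[R]_2 -> R^o) p) }.

Definition smooth_fun {R : realType} {M : oriented_surface R}
    (U : set M) (f : M -> R) : Prop :=
  forall c : chart R M, atlas c ->
    smooth_on (cmap c @` (U `&` cdom c)) (f \o cinv c).

(* T_x M is R^2, a tangent vector at x being given by its components in the
   chart chart_at x. *)
Definition TM {R : realType} (M : oriented_surface R) (x : M) : lmodType R :=
  'rV[R]_2.

(* df_x(v) *)
Definition dfun {R : realType} {M : oriented_surface R} (f : M -> R) (x : M)
    (v : TM x) : R :=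
  'D_v (f \o cinv (chart_at x) : 'rV[R]_2 -> R^o) (cmap (chart_at x) x).

(* The components in the chart c of a tangent vector at x. *)
Definition tcoord {R : realType} {M : oriented_surface R} (c : chart R M)
    (x : M) (v : TM x) : 'rV[R]_2 :=
  \row_(i < 2) dfun (fun y => cmap c y 0 i) v.

Definition smooth_vf {R : realType} {M : oriented_surface R} (U : set M)
    (X : forall x : M, TM x) : Prop :=
  forall c : chart R M, atlas c -> forall i : 'I_2,
    smooth_fun (U `&` cdom c) (fun y => tcoord c (X y) 0 i).

(* In the coordinates of chart_at x,
   [X,Y]^i = X(Y^i) - Y(X^i). *)
Definition lie_bracket {R : realType} {M : oriented_surface R}
    (X Y : forall x : M, TM x) (x : M) : TM x :=
  \row_(i < 2)
    (dfun (fun y => tcoord (chart_at x) (Y y) 0 i) (X x)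
     - dfun (fun y => tcoord (chart_at x) (X y) 0 i) (Y x)).

Definition positive_basis {R : realType} {M : oriented_surface R} (x : M)
    (u v : TM x) : Prop :=
  0 < \det (\matrix_(i < 2, j < 2)
             (if i == 0 then (u : 'rV[R]_2) 0 j else (v : 'rV[R]_2) 0 j)).

(* Functions with values in H^C, differentiated componentwise. *)
Definition smooth_q {R : realType} {M : oriented_surface R} (U : set M)
    (f : M -> 'rV[R[i]]_4) : Prop :=
  forall j : 'I_4, smooth_fun U (fun y => complex.Re (f y 0 j)) /\
                   smooth_fun U (fun y => complex.Im (f y 0 j)).

Definition dq {R : realType} {M : oriented_surface R} (f : M -> 'rV[R[i]]_4)
    (x : M) (v : TM x) : 'rV[R[i]]_4 :=
  \row_(j < 4) (dfun (fun y => complex.Re (f y 0 j)) v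
                +i* dfun (fun y => complex.Im (f y 0 j)) v).

(** * Vector bundles, metrics, connections *)

(* The smooth structure is given by local frames covering M. *)
Record rank2_bundle (R : realType) (M : oriented_surface R) := Rank2Bundle {
  fib :> M -> lmodType R;
  triv : set (set M * ('I_2 -> forall x, fib x));
  triv_open : forall t, triv t -> open t.1;
  triv_cover : forall x, exists2 t, triv t & t.1 x;
  triv_basis : forall t, triv t -> forall x, t.1 x -> forall v : fib x,
    exists! a : 'rV[R]_2, v = \sum_(i < 2) a 0 i *: t.2 i x;
  triv_smooth : forall t t', triv t -> triv t' -> forall j : 'I_2,
    exists a : 'I_2 -> M -> R,
      (forall i, smooth_fun (t.1 `&` t'.1) (a i)) /\
      (forall x, (t.1 `&` t'.1) x -> t'.2 j x = \sum_(i < 2) a i x *: t.2 i x) }.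

Definition smooth_section {R : realType} {M : oriented_surface R}
    (E : rank2_bundle M) (U : set M) (s : forall x, E x) : Prop :=
  forall t, triv t -> exists a : 'I_2 -> M -> R,
    (forall i, smooth_fun (U `&` t.1) (a i)) /\
    (forall x, (U `&` t.1) x -> s x = \sum_(i < 2) a i x *: t.2 i x).

(* In the next definitions V is either TM or a rank 2 bundle, and
   sm U s says that s is smooth on the open set U (smooth_vf or
   smooth_section). *)
Definition smooth_near {R : realType} {M : oriented_surface R}
    {V : M -> lmodType R} (sm : set M -> (forall x, V x) -> Prop)
    (x : M) (s : forall x, V x) : Prop :=
  exists U, [/\ open U, U x & sm U s].

Record is_metric {R : realType} {M : oriented_surface R}
    {V : M -> lmodType R} (sm : set M -> (forall x, V x) -> Prop)
    (g : forall x, V x -> V x -> R) : Prop := {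
  metric_linear : forall x (a : R) (u v w : V x),
    g x (a *: u + v) w = a * g x u w + g x v w;
  metric_sym : forall x (u v : V x), g x u v = g x v u;
  metric_smooth : forall U s t, open U -> sm U s -> sm U t ->
    smooth_fun U (fun x => g x (s x) (t x)) }.

(* nabla s x v is the covariant derivative at x, in the direction v, of a
   section s that is smooth near x; it depends only on the germ of s. *)
Record is_connection {R : realType} {M : oriented_surface R}
    {V : M -> lmodType R} (sm : set M -> (forall x, V x) -> Prop)
    (nabla : (forall x, V x) -> forall x : M, TM x -> V x) : Prop := {
  conn_local : forall U s t, open U -> sm U s -> sm U t ->
    (forall x, U x -> s x = t x) ->
    forall x, U x -> forall v, nabla s x v = nabla t x v;
  conn_linear : forall x s, smooth_near sm x s ->
    forall (a : R) (v w : TM x),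
    nabla s x (a *: v + w) = a *: nabla s x v + nabla s x w;
  conn_add : forall x s t, smooth_near sm x s -> smooth_near sm x t ->
    forall v : TM x,
    nabla (fun y => s y + t y) x v = nabla s x v + nabla t x v;
  conn_leibniz : forall x (U : set M) (f : M -> R) s,
    open U -> U x -> smooth_fun U f -> sm U s -> forall v : TM x,
    nabla (fun y => f y *: s y) x v
    = dfun f v *: s x + f x *: nabla s x v;
  conn_smooth : forall U s X, open U -> sm U s -> smooth_vf U X ->
    sm U (fun x => nabla s x (X x)) }.

Definition metric_compatible {R : realType} {M : oriented_surface R}
    {V : M -> lmodType R} (sm : set M -> (forall x, V x) -> Prop)
    (g : forall x, V x -> V x -> R)
    (nabla : (forall x, V x) -> forall x : M, TM x -> V x) : Prop :=
  forall x s t, smooth_near sm x s -> smooth_near sm x t ->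
  forall v : TM x,
  dfun (fun y => g y (s y) (t y)) v
  = g x (nabla s x v) (t x) + g x (s x) (nabla t x v).

Definition curvature {R : realType} {M : oriented_surface R}
    {V : M -> lmodType R}
    (nabla : (forall x, V x) -> forall x : M, TM x -> V x)
    (X Y : forall x : M, TM x) (s : forall x, V x) (x : M) : V x :=
  nabla (fun y => nabla s y (Y y)) x (X x)
  - nabla (fun y => nabla s y (X y)) x (Y x)
  - nabla s x (lie_bracket X Y x).

Definition riemannian {R : realType} {M : oriented_surface R}
    (g : forall x : M, TM x -> TM x -> R) : Prop :=
  is_metric smooth_vf g /\ forall x (v : TM x), v != 0 -> 0 < g x v v.

Definition levi_civita {R : realType} {M : oriented_surface R}
    (g : forall x : M, TM x -> TM x -> R)
    (nabla : (forall x : M, TM x) -> forall x : M, TM x -> TM x) : Prop :=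
  [/\ is_connection smooth_vf nabla,
      metric_compatible smooth_vf g nabla
    & forall x X Y, smooth_near smooth_vf x X -> smooth_near smooth_vf x Y ->
      nabla Y x (X x) - nabla X x (Y x) = lie_bracket X Y x].

Definition signature11 {R : realType} {M : oriented_surface R}
    (E : rank2_bundle M) (g : forall x, E x -> E x -> R) : Prop :=
  is_metric (smooth_section (E:=E)) g /\
  forall x, exists u v : E x,
    [/\ g x u u = -1, g x v v = 1 & g x u v = 0].

(* For a signature (1,1) form q, the set {q(v,v) > 0} has two connected
   components, and the component of e is {q(v,v) > 0, q(v,e) > 0}. C selects
   one of them in each fiber, continuously in x. Taking q = - g, this is a
   time orientation; taking q = g, a space orientation. *)
Definition cone_orientation {R : realType} {M : oriented_surface R}
    (E : rank2_bundle M) (q : forall x, E x -> E x -> R)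
    (C : forall x, set (E x)) : Prop :=
  (forall x, exists2 e : E x, 0 < q x e e &
     C x = [set v | 0 < q x v v /\ 0 < q x v e]) /\
  (forall x, exists U s, [/\ open U, U x, smooth_section U s &
     forall y, U y -> C y (s y)]).

(* The bundles Q_1 and Q_2 of positively oriented orthonormal frames. *)
Definition frameE {R : realType} {M : oriented_surface R}
    (E : rank2_bundle M) (g : forall x, E x -> E x -> R)
    (future rightward : forall x, set (E x)) (x : M) (e0 e1 : E x) : Prop :=
  [/\ g x e0 e0 = -1, g x e1 e1 = 1, g x e0 e1 = 0,
      future x e0 & rightward x e1].

Definition frameM {R : realType} {M : oriented_surface R}
    (g : forall x : M, TM x -> TM x -> R) (x : M) (e2 e3 : TM x) : Prop :=
  [/\ g x e2 e2 = 1, g x e3 e3 = 1, g x e2 e3 = 0 & positive_basis e2 e3].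

(* sqrt(det g) dx^1 /\ dx^2 in the coordinates of chart_at x. *)
Definition area_form {R : realType} {M : oriented_surface R}
    (g : forall x : M, TM x -> TM x -> R) (x : M) (X Y : TM x) : R :=
  Num.sqrt (\det (\matrix_(i < 2, j < 2) g x (stdv i) (stdv j)))
  * \det (\matrix_(i < 2, j < 2)
           (if i == 0 then (X : 'rV[R]_2) 0 j else (Y : 'rV[R]_2) 0 j)).

Definition gauss_curvature {R : realType} {M : oriented_surface R}
    (g : forall x : M, TM x -> TM x -> R)
    (nabla : (forall x : M, TM x) -> forall x : M, TM x -> TM x)
    (K : M -> R) : Prop :=
  forall (U : set M) (e2 e3 : forall x : M, TM x),
    open U -> smooth_vf U e2 -> smooth_vf U e3 ->
    (forall x, U x -> frameM g (e2 x) (e3 x)) ->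
    forall x, U x -> K x = g x (curvature nabla e2 e3 e3 x) (e2 x).

Definition bundle_curvature {R : realType} {M : oriented_surface R}
    (gM : forall x : M, TM x -> TM x -> R)
    (E : rank2_bundle M) (gE : forall x, E x -> E x -> R)
    (future rightward : forall x, set (E x))
    (nablaE : (forall x, E x) -> forall x : M, TM x -> E x)
    (KN : M -> R) : Prop :=
  forall (U : set M) (e0 e1 : forall x, E x) (e2 e3 : forall x : M, TM x),
    open U -> smooth_section U e0 -> smooth_section U e1 ->
    smooth_vf U e2 -> smooth_vf U e3 ->
    (forall x, U x -> frameE gE future rightward (e0 x) (e1 x)) ->
    (forall x, U x -> frameM gM (e2 x) (e3 x)) ->
    forall x, U x -> KN x = gE x (curvature nablaE e2 e3 e0 x) (e1 x).

(** * Spin structures and spinors *)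

(* A principal bundle with group Grp, a double cover of the bundle Q of
   oriented orthonormal frames of V; b0, b1 are the two elements of R^{1,3}
   modelling the vectors of a frame of V. The smooth structure is given by
   the local sections spin_loc. By spin_equiv, if a vector has coordinate xi
   in p, and xi' in p g, then xi = g xi' (hat g)^-1. *)
Record spin_structure (R : realType) (M : oriented_surface R)
    (V : M -> lmodType R) (sm : set M -> (forall x, V x) -> Prop)
    (Q : forall x, V x -> V x -> Prop)
    (Grp : set 'rV[R[i]]_4) (b0 b1 : 'rV[R[i]]_4) := SpinStructure {
  spin :> M -> Type;
  spin_act : forall x, spin x -> 'rV[R[i]]_4 -> spin x;
  spin_fr0 : forall x, spin x -> V x;
  spin_fr1 : forall x, spin x -> V x;
  spin_loc : set (set M * (forall x, spin x));
  spin_act1 : forall x (p : spin x), spin_act p qone = p;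
  spin_actM : forall x (p : spin x) g h, Grp g -> Grp h ->
    spin_act (spin_act p g) h = spin_act p (g ** h);
  spin_torsor : forall x (p p' : spin x),
    exists! g, Grp g /\ p' = spin_act p g;
  spin_frame : forall x (p : spin x), Q x (spin_fr0 p) (spin_fr1 p);
  spin_equiv : forall x (p : spin x) g, Grp g -> forall a0 a1 a0' a1' : R,
    a0%:C *: b0 + a1%:C *: b1
      = g ** (a0'%:C *: b0 + a1'%:C *: b1) ** qinv (qhat g) ->
    a0 *: spin_fr0 p + a1 *: spin_fr1 p
      = a0' *: spin_fr0 (spin_act p g) + a1' *: spin_fr1 (spin_act p g);
  spin_loc_open : forall t, spin_loc t -> open t.1;
  spin_loc_cover : forall x, exists2 t, spin_loc t & t.1 x;
  spin_loc_frame : forall t, spin_loc t ->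
    sm t.1 (fun x => spin_fr0 (t.2 x)) /\ sm t.1 (fun x => spin_fr1 (t.2 x));
  spin_loc_smooth : forall t t', spin_loc t -> spin_loc t' ->
    exists2 g : M -> 'rV[R[i]]_4, smooth_q (t.1 `&` t'.1) g &
      forall x, (t.1 `&` t'.1) x ->
        Grp (g x) /\ t'.2 x = spin_act (t.2 x) (g x) }.

Definition spinE {R : realType} {M : oriented_surface R}
    (E : rank2_bundle M) (gE : forall x, E x -> E x -> R)
    (future rightward : forall x, set (E x)) :=
  spin_structure (smooth_section (E:=E)) (frameE gE future rightward)
    Spin11 ('i *: qone) qI.

Definition spinM {R : realType} {M : oriented_surface R}
    (gM : forall x : M, TM x -> TM x -> R) :=
  spin_structure smooth_vf (frameM gM) Spin2 qJ qK.

(* A section of Sigma = Qtilde x_rho H^C as an equivariant map: phi x p1 p2 is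
   the coordinate [phi] at x in (p1, p2). *)
Definition spinor_field {R : realType} {M : oriented_surface R}
    {gM : forall x : M, TM x -> TM x -> R}
    {E : rank2_bundle M} {gE : forall x, E x -> E x -> R}
    {future rightward : forall x, set (E x)}
    (S1 : spinE gE future rightward) (S2 : spinM gM)
    (phi : forall x, S1 x -> S2 x -> 'rV[R[i]]_4) : Prop :=
  (forall x (p1 : S1 x) (p2 : S2 x) g1 g2, Spin11 g1 -> Spin2 g2 ->
     phi x p1 p2 = g1 ** g2 ** phi x (spin_act p1 g1) (spin_act p2 g2)) /\
  (forall t1 t2, spin_loc t1 -> spin_loc t2 ->
     smooth_q (t1.1 `&` t2.1) (fun x => phi x (t1.2 x) (t2.2 x))).

Section Spinors.
Context {R : realType} {M : oriented_surface R}
  {gM : forall x : M, TM x -> TM x -> R}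
  {E : rank2_bundle M} {gE : forall x, E x -> E x -> R}
  {future rightward : forall x, set (E x)}
  (S1 : spinE gE future rightward) (S2 : spinM gM).

(* [h + X], for h in E and X in TM. *)
Definition vcoord (x : M) (p1 : S1 x) (p2 : S2 x) (h : E x) (X : TM x) :
    'rV[R[i]]_4 :=
  mink (- gE h (spin_fr0 p1)) (gE h (spin_fr1 p1))
       (gM X (spin_fr0 p2)) (gM X (spin_fr1 p2)).

Definition clifford (x : M) (p1 : S1 x) (p2 : S2 x) (h : E x) (X : TM x)
    (psi : 'rV[R[i]]_4) : 'rV[R[i]]_4 :=
  vcoord p1 p2 h X ** qhat psi.

Definition pairing (psi psi' : 'rV[R[i]]_4) : 'rV[R[i]]_4 :=
  qbar psi' ** psi.

(* The coordinate of nabla_v phi in the local section (s1, s2), lying over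
   (e0, e1, e2, e3). The connection induced on Sigma is
     d phi + 1/2 sum_(i<j) eps_i eps_j <nabla e_i, e_j> e_i . e_j . phi
   with eps_0 = -1, eps_1 = eps_2 = eps_3 = 1; the mixed terms vanish. *)
Definition spin_nabla
    (nablaE : (forall x, E x) -> forall x : M, TM x -> E x)
    (nablaM : (forall x : M, TM x) -> forall x : M, TM x -> TM x)
    (phi : forall x, S1 x -> S2 x -> 'rV[R[i]]_4)
    (s1 : forall x, S1 x) (s2 : forall x, S2 x) (x : M) (v : TM x) :
    'rV[R[i]]_4 :=
  let e0 y := spin_fr0 (s1 y) in
  let e1 y := spin_fr1 (s1 y) in
  let e2 y := spin_fr0 (s2 y) in
  let e3 y := spin_fr1 (s2 y) in
  let psi := phi x (s1 x) (s2 x) in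
  let cl := clifford (s1 x) (s2 x) in
  dq (fun y => phi y (s1 y) (s2 y)) v
  + (- gE (nablaE e0 x v) (e1 x) / 2)%:C *: cl (e0 x) 0 (cl (e1 x) 0 psi)
  + (gM (nablaM e2 x v) (e3 x) / 2)%:C *: cl 0 (e2 x) (cl 0 (e3 x) psi).

(* D phi = H . phi *)
Definition dirac_equation
    (nablaE : (forall x, E x) -> forall x : M, TM x -> E x)
    (nablaM : (forall x : M, TM x) -> forall x : M, TM x -> TM x)
    (Hv : forall x, E x)
    (phi : forall x, S1 x -> S2 x -> 'rV[R[i]]_4) : Prop :=
  forall t1 t2, spin_loc t1 -> spin_loc t2 ->
  forall x, (t1.1 `&` t2.1) x ->
  let e2 := spin_fr0 (t2.2 x) in
  let e3 := spin_fr1 (t2.2 x) in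
  let cl := clifford (t1.2 x) (t2.2 x) in
  cl 0 e2 (spin_nabla nablaE nablaM phi t1.2 t2.2 e2)
  + cl 0 e3 (spin_nabla nablaE nablaM phi t1.2 t2.2 e3)
  = cl (Hv x) 0 (phi x (t1.2 x) (t2.2 x)).

(* F is the isometric immersion with dF(X) = <<X . phi, phi>>. *)
Definition immersion_given_by
    (phi : forall x, S1 x -> S2 x -> 'rV[R[i]]_4)
    (F : M -> 'rV[R[i]]_4) : Prop :=
  [/\ smooth_q setT F,
      forall x, minkowski (F x),
      forall x (X Y : TM x), qH (dq F X) (dq F Y) = (gM X Y)%:C
    & forall x (p1 : S1 x) (p2 : S2 x) (X : TM x),
        dq F X = pairing (clifford p1 p2 0 X (phi x p1 p2)) (phi x p1 p2)].

End Spinors.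

Definition gauss_map {R : realType} {M : oriented_surface R}
    (F G : M -> 'rV[R[i]]_4) : Prop :=
  forall x (u v : TM x), positive_basis u v ->
    qH (dq F u) (dq F u) = 1 -> qH (dq F v) (dq F v) = 1 ->
    qH (dq F u) (dq F v) = 0 ->
    G x = wedge (dq F u) (dq F v).

(* Main.v *)
Require Import Defs.
From mathcomp Require Import all_boot all_order all_algebra.
From mathcomp Require Import all_classical all_reals all_analysis.
From mathcomp Require Import complex.
From mathcomp Require Import ring lra.

Set Implicit Arguments.
Unset Strict Implicit.
Unset Printing Implicit Defensive.

Import Order.TTheory GRing.Theory Num.Theory.
Import numFieldNormedType.Exports.

Local Open Scope classical_set_scope.
Local Open Scope ring_scope.
Local Open Scope complex_scope.

(** The proof is a Maurer-Cartan computation. Over a pair of local spin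
frames, over an orthonormal frame (e0, e1, e2, e3), the spinor has a
coordinate psi with H(psi, psi) = 1, hence psi^-1 = qbar psi, and
alpha = dpsi psi^-1 is a 1-form with imaginary values
alpha1 I + alpha2 J + alpha3 K.

The spinor connection is dpsi + eta I psi, where 2 eta = b - i a with
b = <nabla e2, e3> and a = <nabla e0, e1>. The scalar part of alpha vanishes,
and the J and K components of the Dirac equation then say exactly that
alpha1 = - eta ([dirac_components], [dpsi_I_spin_form]). On a bundle of rank 2
with a metric connection the curvature is the exterior derivative of the
connection form ([curvature_form]), so that
K + i K_N = - 2 d eta (e2, e3) = 2 d alpha1 (e2, e3). The right-hand side is
known from the integrability d alpha = alpha /\ alpha, which is the symmetry
of second derivatives of psi ([dfun_bracket], [maurer_cartan_I]):
K + i K_N = 4 (alpha2 /\ alpha3)(e2, e3) ([curvature_spinor]).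

On the other side, dF(e2) = qbar psi J qhat psi and dF(e3) = qbar psi K qhat psi
give G = psi^-1 I psi ([gauss_map_spinor]), hence
dG = psi^-1 [I, alpha] psi = 2 psi^-1 (alpha2 K - alpha3 J) psi. Conjugation by
psi preserves the complex area form of the quadric, and
omega_Q(dG e2, dG e3) = 4 (alpha2 /\ alpha3)(e2, e3) as well
([omegaQ_dgauss]). As both sides of the formula are bilinear and alternating
in the tangent vectors, evaluating them on the frame suffices
([gauss_pullback]).

For the second assertion, at a point p of the quadric the cross product of two
tangent vectors is omega_Q(v, w) p, so omega_Q(v, w) = 0 means that v and w are
proportional over the complex numbers ([omegaQ_eq0_line]); this is applied to
dG(e2) and dG(e3), where the area form equals 1. *)

(** * Symmetry of second derivatives *)

Section Calculus.
Context {R : realType} {V : normedModType R}.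
Implicit Types (f : V -> R^o) (p q u v : V).

Lemma is_derive_line f p u (s : R) : differentiable f (s *: u + p) ->
  is_derive s 1 (fun t : R => f (t *: u + p) : R^o) ('D_u f (s *: u + p)).
Proof.
move=> df.
have dl : is_diff s (fun t : R => t *: u + p) ( *:%R^~ u).
  by apply: is_diff_eq; rewrite addr0.
have dc : differentiable (f \o (fun t : R => t *: u + p)) s.
  exact: differentiable_comp.
apply: DeriveDef; first exact: diff_derivable.
rewrite deriveE// deriveE// diff_comp//=.
by have [_ ->] := dl; rewrite scale1r.
Qed.

Lemma derive_translate f p q u :
  differentiable f (q + p) -> differentiable (fun z => f (z + p) : R^o) q /\
  'D_u (fun z => f (z + p) : R^o) q = 'D_u f (q + p).
Proof.
move=> df.
have dl : is_diff q (fun z => z + p) id.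
  by apply: is_diff_eq; rewrite addr0.
have dc : differentiable (f \o (fun z => z + p)) q.
  exact: differentiable_comp.
split=> //; rewrite deriveE// deriveE// diff_comp//=.
by have [_ ->] := dl.
Qed.

Lemma MVT_line f p u (h : R) : 0 <= h ->
  (forall s : R, 0 <= s <= h -> differentiable f (s *: u + p)) ->
  exists2 s : R, 0 <= s <= h & f (h *: u + p) - f p = 'D_u f (s *: u + p) * h.
Proof.
move=> h0 df.
pose g : R -> R := fun t => f (t *: u + p).
pose dg : R -> R := fun s => 'D_u f (s *: u + p).
have dgP s : 0 <= s <= h -> is_derive s 1 g (dg s).
  by move=> hs; exact: is_derive_line (df _ hs).
have dgP' s : s \in `]0, h[%R -> is_derive s 1 g (dg s).
  by rewrite in_itv /= => /andP[s0 sh]; apply: dgP; rewrite !ltW.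
have gc : {within `[0, h], continuous g}.
  apply: derivable_within_continuous => s; rewrite in_itv /= => hs.
  by have [] := dgP _ hs.
have [s] := MVT_segment h0 dgP' gc.
by rewrite /g /dg in_itv /= scale0r add0r subr0 => hs e; exists s.
Qed.

(** Two applications of the mean value theorem: in the direction u to the
    increment of f along h v, and then in the direction v to D_u f. *)
Lemma second_difference f p u v (h : R) : 0 <= h ->
  (forall s t : R, 0 <= s <= h -> 0 <= t <= h ->
     differentiable f (t *: v + (s *: u + p)) /\
     differentiable ('D_u f) (t *: v + (s *: u + p))) ->
  exists s t : R, [/\ 0 <= s <= h, 0 <= t <= h &
    f (h *: v + (h *: u + p)) - f (h *: u + p) - (f (h *: v + p) - f p)
    = 'D_v ('D_u f) (t *: v + (s *: u + p)) * h * h].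
Proof.
move=> h0 df.
pose g : V -> R^o := (fun z => f (z + h *: v) : R^o) - f.
have hh : 0 <= h <= h by rewrite h0 lexx.
have h00 : 0 <= (0 : R) <= h by rewrite h0 andbT.
have dgE s : 0 <= s <= h -> differentiable g (s *: u + p) /\
   'D_u g (s *: u + p)
   = 'D_u f (h *: v + (s *: u + p)) - 'D_u f (s *: u + p).
  move=> hs.
  have d0 : differentiable f (s *: u + p).
    by have [+ _] := df s 0 hs h00; rewrite scale0r add0r.
  have d1 : differentiable f (s *: u + p + h *: v).
    by have [+ _] := df s h hs hh; rewrite addrC.
  have [e1 e2] := derive_translate u d1.
  split; first exact: differentiableB.
  rewrite /g deriveB; [|exact: diff_derivable..].
  by rewrite e2 [in h *: v + _]addrC.
have [s hs Es] := MVT_line h0 (fun s hs => (dgE s hs).1).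
have [t ht Et] := @MVT_line ('D_u f) (s *: u + p) v h h0
  (fun t ht => (df s t hs ht).2).
exists s, t; split=> //.
have gE z : g z = f (h *: v + z) - f z by rewrite /g [h *: v + z]addrC.
by rewrite -!gE Es (dgE s hs).2 Et.
Qed.

(** The second difference of f over a parallelogram of sides h u and h v is
    symmetric in u and v. By [second_difference] it is h^2 times a value of
    each of the mixed derivatives at points of the parallelogram, and these
    values converge as h tends to 0. *)
Lemma derive_swap f p u v :
  (\forall q \near p, differentiable f q) ->
  (\forall q \near p, differentiable ('D_u f) q) ->
  (\forall q \near p, differentiable ('D_v f) q) ->
  {for p, continuous ('D_v ('D_u f))} -> {for p, continuous ('D_u ('D_v f))} ->
  'D_v ('D_u f) p = 'D_u ('D_v f) p.
Proof.
move=> df duf dvf cvu cuv.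
apply/eqP; rewrite -subr_eq0 -normr_eq0 eq_le normr_ge0 andbT.
apply/ler_addgt0Pr => e e0; rewrite add0r.
have e2 : 0 < e / 2 by rewrite divr_gt0.
have : \forall q \near p, [/\ differentiable f q, differentiable ('D_u f) q,
    differentiable ('D_v f) q, `|'D_v ('D_u f) p - 'D_v ('D_u f) q| < e / 2 &
    `|'D_u ('D_v f) p - 'D_u ('D_v f) q| < e / 2].
  have nvu : \forall q \near p, `|'D_v ('D_u f) p - 'D_v ('D_u f) q| < e / 2.
    exact: (cvgrPdist_lt _ _).1 cvu _ e2.
  have nuv : \forall q \near p, `|'D_u ('D_v f) p - 'D_u ('D_v f) q| < e / 2.
    exact: (cvgrPdist_lt _ _).1 cuv _ e2.
  apply: filterS (filterI (filterI (filterI df duf) dvf) (filterI nvu nuv)).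
  by move=> q [[[? ?] ?] [? ?]]; split.
move=> /nbhs_ballP[r /= r0 Hr].
(* All points of the parallelogram of sides h u and h v are in the ball. *)
pose h := r / (`|u| + `|v| + 1) / 2.
have n0 : 0 < `|u| + `|v| + 1 by rewrite ltr_wpDl// addr_ge0.
have h0 : 0 < h by rewrite !divr_gt0.
have hr : h * (`|u| + `|v|) < r.
  rewrite /h mulrAC ltr_pdivrMr// mulrAC ltr_pdivrMr// -mulrA ltr_pM2l//.
  have : 0 <= `|u| + `|v| by rewrite addr_ge0.
  lra.
have inb a b : (0 <= a <= h) -> (0 <= b <= h) -> ball p r (b *: v + (a *: u + p)).
  move=> /andP[a0 ah] /andP[b0 bh]; rewrite -ball_normE /ball_/=.
  rewrite distrC addrA addrK (le_lt_trans _ hr)//.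
  rewrite (le_trans (ler_normD _ _))// !normrZ !ger0_norm// mulrDr addrC.
  by rewrite lerD// ler_wpM2r.
have [s [t [hs ht E1]]] : exists s t : R, [/\ 0 <= s <= h, 0 <= t <= h &
    f (h *: v + (h *: u + p)) - f (h *: u + p) - (f (h *: v + p) - f p)
    = 'D_v ('D_u f) (t *: v + (s *: u + p)) * h * h].
  apply: second_difference; first exact: ltW.
  by move=> a b ha hb; have [] := Hr _ (inb _ _ ha hb).
have [s' [t' [hs' ht' E2]]] : exists s t : R, [/\ 0 <= s <= h, 0 <= t <= h &
    f (h *: u + (h *: v + p)) - f (h *: v + p) - (f (h *: u + p) - f p)
    = 'D_u ('D_v f) (t *: u + (s *: v + p)) * h * h].
  apply: second_difference; first exact: ltW.
  move=> a b ha hb; rewrite addrCA.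
  by have [] := Hr _ (inb _ _ hb ha).
have E : 'D_v ('D_u f) (t *: v + (s *: u + p))
       = 'D_u ('D_v f) (t' *: u + (s' *: v + p)).
  apply: (mulIf (lt0r_neq0 h0)); apply: (mulIf (lt0r_neq0 h0)).
  apply: (etrans (esym E1)); apply: etrans E2.
  rewrite [h *: u + (h *: v + p)]addrCA !opprB addrACA [RHS]addrACA.
  by rewrite [- f (h *: v + p) - _]addrC.
have [_ _ _ H1 _] := Hr _ (inb _ _ hs ht).
have [_ _ _ _ H2] := Hr _ (inb _ _ ht' hs').
rewrite [s' *: v + _]addrCA -E in H2.
rewrite (splitr e); apply: le_trans (ler_distD _ _ _) _; apply: lerD.
  exact: ltW H1.
by rewrite distrC; exact: ltW H2.
Qed.

End Calculus.

(** * Derivatives in the plane *)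

Section Plane.
Context {R : realType}.
Implicit Types (f g : 'rV[R]_2 -> R^o) (p q u v : 'rV[R]_2).

Lemma derive_linear f p (a : R) u v : differentiable f p ->
  'D_(a *: u + v) f p = a * 'D_u f p + 'D_v f p.
Proof. by move=> df; rewrite !deriveE// linearP. Qed.

Lemma derive_stdv f p v : differentiable f p ->
  'D_v f p = \sum_(i < 2) v 0 i * 'D_(stdv i) f p.
Proof.
move=> df; rewrite !deriveE// {1}[v]row_sum_delta linear_sum.
by apply: eq_bigr => i _; rewrite linearZ deriveE.
Qed.

Lemma differentiable_row (T : 'rV[R]_2 -> 'rV[R]_2) p :
  (forall i : 'I_2, differentiable (fun q => T q 0 i : R^o) p) ->
  differentiable T p.
Proof.
move=> dT.
have -> : T = \sum_(i < 2) (fun q => T q 0 i *: stdv i).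
  apply/funext => q; rewrite {1}[T q]row_sum_delta.
  by rewrite fct_sumE.
by apply: differentiable_sum => i; exact: differentiableZl.
Qed.

Lemma derive_chain f (T : 'rV[R]_2 -> 'rV[R]_2) p v :
  (forall i : 'I_2, differentiable (fun q => T q 0 i : R^o) p) ->
  differentiable f (T p) ->
  differentiable (f \o T) p /\
  'D_v (f \o T) p = 'D_(\row_i 'D_v (fun q => T q 0 i : R^o) p) f (T p).
Proof.
move=> dT df; have dT' := differentiable_row dT.
have dfT := differentiable_comp dT' df.
split=> //.
rewrite deriveE// [RHS]deriveE// diff_comp//=; congr ('d f (T p) _).
rewrite -deriveE// derive_mx; last exact: diff_derivable.
by apply/matrixP => i j; rewrite !mxE ord1.
Qed.

Lemma smooth_on_sub (U U' : set 'rV[R]_2) f :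
  U' `<=` U -> smooth_on U f -> smooth_on U' f.
Proof.
move=> sU sf n; move: (sf n); elim: n f {sf} => [|n IH] f /= [df Df].
  by split=> // p /sU; exact: df.
by split=> [p /sU|v]; [exact: df|exact: IH].
Qed.

(** Being smooth is an assertion about every order; orders up to 2 are the
    ones that the exterior derivative of an exact form involves. *)
Lemma smooth_on_diff (U : set 'rV[R]_2) f p u v : smooth_on U f -> U p ->
  [/\ differentiable f p, differentiable ('D_u f) p &
      differentiable ('D_v ('D_u f)) p].
Proof.
move=> sf Up; have /= [d0 /(_ u) [d1 /(_ v) [d2 _]]] := sf 2%N.
by split; [exact: d0|exact: d1|exact: d2].
Qed.

Lemma smooth_on_derive_swap (U : set 'rV[R]_2) f p u v :
  smooth_on U f -> (\forall q \near p, U q) ->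
  'D_v ('D_u f) p = 'D_u ('D_v f) p.
Proof.
move=> sf nU; have Up := nbhs_singleton nU.
have [_ _ cvu] := smooth_on_diff u v sf Up.
have [_ _ cuv] := smooth_on_diff v u sf Up.
apply: derive_swap.
- by apply: filterS nU => q Uq; have [] := smooth_on_diff u v sf Uq.
- by apply: filterS nU => q Uq; have [] := smooth_on_diff u v sf Uq.
- by apply: filterS nU => q Uq; have [] := smooth_on_diff v u sf Uq.
- exact: differentiable_continuous cvu.
- exact: differentiable_continuous cuv.
Qed.

End Plane.

(** * Derivatives of functions on a surface *)

Section Surface.
Context {R : realType} {M : oriented_surface R}.
Implicit Types (f g : M -> R) (U : set M).

(** In terms of the coordinate q, all points near x lie in U and the two
    maps of the chart are inverse to each other there. *)
Lemma near_chart (c : chart R M) U x : open U -> U x -> cdom c x ->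
  \forall q \near cmap c x,
    [/\ U (cinv c q), cdom c (cinv c q) & cmap c (cinv c q) = q].
Proof.
move=> oU Ux cx.
have ix : (cmap c @` cdom c) (cmap c x) by exists x.
have n1 : \forall q \near cmap c x, (cmap c @` cdom c) q.
  apply: open_nbhs_nbhs; split=> //; exact: cimg_open.
have n2 : \forall q \near cmap c x, U (cinv c q).
  apply: (cinv_cts ix); rewrite cmapK//.
  exact: open_nbhs_nbhs.
apply: filterS (filterI n1 n2) => q [[y cy <-]].
by rewrite cmapK.
Qed.

Lemma near_chart_img (c : chart R M) U x : open U -> U x -> cdom c x ->
  \forall q \near cmap c x, (cmap c @` (U `&` cdom c)) q.
Proof.
move=> oU Ux cx; apply: filterS (near_chart oU Ux cx) => q [Uq cq qq].
by exists (cinv c q).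
Qed.

Lemma smooth_fun_sub U U' f : U' `<=` U -> smooth_fun U f -> smooth_fun U' f.
Proof.
move=> sU sf c ac; apply: smooth_on_sub (sf c ac).
by move=> _ [y [Uy cy] <-]; exists y => //; split=> //; exact: sU.
Qed.

Lemma smooth_vf_sub U U' (X : forall x : M, TM x) :
  U' `<=` U -> smooth_vf U X -> smooth_vf U' X.
Proof.
move=> sU sX c ac i; apply: smooth_fun_sub (sX c ac i).
by move=> y [Uy cy]; split=> //; exact: sU.
Qed.

Lemma smooth_section_sub (E : rank2_bundle M) U U' (s : forall x, E x) :
  U' `<=` U -> smooth_section U s -> smooth_section U' s.
Proof.
move=> sU ss t tt; have [a [sa Es]] := ss t tt; exists a; split.
  by move=> i; apply: smooth_fun_sub (sa i) => y [Uy ty]; split=> //; exact: sU.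
by move=> y [Uy ty]; apply: Es; split=> //; exact: sU.
Qed.

Lemma eq_dfun U f g x (v : TM x) : open U -> U x ->
  (forall y, U y -> f y = g y) -> dfun f v = dfun g v.
Proof.
move=> oU Ux fg; apply: near_eq_derive.
apply: filterS (near_chart oU Ux (chart_at_dom x)) => q [Uq _ _] /=.
exact: fg.
Qed.

Definition derivable_fun f (x : M) (v : TM x) :=
  derivable (f \o cinv (chart_at x) : 'rV[R]_2 -> R^o)
            (cmap (chart_at x) x) v.

Lemma derivable_funD f g x (v : TM x) : derivable_fun f v ->
  derivable_fun g v -> derivable_fun (fun y => f y + g y) v.
Proof. exact: derivableD. Qed.

Lemma derivable_funN f x (v : TM x) :
  derivable_fun f v -> derivable_fun (fun y => - f y) v.
Proof. exact: derivableN. Qed.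

Lemma derivable_funM f g x (v : TM x) : derivable_fun f v ->
  derivable_fun g v -> derivable_fun (fun y => f y * g y) v.
Proof. exact: derivableM. Qed.

Lemma dfun_cst (k : R) (x : M) (v : TM x) : dfun (fun _ : M => k) v = 0.
Proof. exact: derive_cst. Qed.

Lemma dfunD f g x (v : TM x) : derivable_fun f v -> derivable_fun g v ->
  dfun (fun y => f y + g y) v = dfun f v + dfun g v.
Proof. exact: deriveD. Qed.

Lemma dfunN f x (v : TM x) : derivable_fun f v ->
  dfun (fun y => - f y) v = - dfun f v.
Proof. exact: deriveN. Qed.

Lemma dfunM f g x (v : TM x) : derivable_fun f v -> derivable_fun g v ->
  dfun (fun y => f y * g y) v = f x * dfun g v + g x * dfun f v.
Proof.
move=> df dg; rewrite /dfun.
rewrite (deriveM (f := f \o cinv (chart_at x)) (g := g \o cinv (chart_at x)))//.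
by rewrite /= cmapK//; exact: chart_at_dom.
Qed.

Lemma smooth_differentiable U f x : open U -> smooth_fun U f -> U x ->
  differentiable (f \o cinv (chart_at x) : 'rV[R]_2 -> R^o)
                 (cmap (chart_at x) x).
Proof.
move=> oU sf Ux; have sc := sf _ (chart_at_atlas x).
have [] // := smooth_on_diff 0 0 sc (p := cmap (chart_at x) x).
by exists x => //; split=> //; exact: chart_at_dom.
Qed.

Lemma smooth_derivable U f x (v : TM x) : open U -> smooth_fun U f -> U x ->
  derivable_fun f v.
Proof.
by move=> oU sf Ux; apply: diff_derivable; exact: smooth_differentiable Ux.
Qed.

Lemma dfun_linear U f x (a : R) (v w : TM x) : open U -> smooth_fun U f ->
  U x -> dfun f (a *: v + w) = a * dfun f v + dfun f w.
Proof.
by move=> oU sf Ux; apply: derive_linear; exact: smooth_differentiable Ux.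
Qed.

(** [dfun] is computed at each point x in its own chart [chart_at x]. To
    differentiate it along a vector field, a single chart c around the point
    has to serve for all nearby points; the change is the chain rule for the
    transition map. *)
Lemma dfun_chart U f (c : chart R M) x (v : TM x) : open U -> smooth_fun U f ->
  atlas c -> U x -> cdom c x ->
  dfun f v = 'D_(tcoord c v) (f \o cinv c : _ -> R^o) (cmap c x).
Proof.
move=> oU sf ac Ux cx; rewrite /dfun; set d := chart_at x.
have ad : atlas d by exact: chart_at_atlas.
have dx : cdom d x by exact: chart_at_dom.
pose T : 'rV[R]_2 -> 'rV[R]_2 := cmap c \o cinv d.
have TE : T (cmap d x) = cmap c x by rewrite /T /= cmapK.
have dT i : differentiable (fun q => T q 0 i : R^o) (cmap d x).
  have [] // := smooth_on_diff 0 0 (atlas_smooth ad ac i) (p := cmap d x).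
  by exists x.
have df : differentiable (f \o cinv c : _ -> R^o) (T (cmap d x)).
  have [] // := smooth_on_diff 0 0 (sf _ ac) (p := T (cmap d x)).
  by rewrite TE; exists x.
have [_ E] := derive_chain v dT df.
have -> : tcoord c v = \row_i 'D_v (fun q => T q 0 i : R^o) (cmap d x).
  by apply/matrixP => i j; rewrite !mxE.
rewrite -TE -E; apply: near_eq_derive.
have oc : open (cdom c) by exact: cdom_open.
have := near_chart oc cx dx; apply: filterS => q [cq _ _] /=.
by rewrite /T /= cmapK.
Qed.

Lemma tcoord_chart_at (x : M) (v : TM x) :
  tcoord (chart_at x) v = (v : 'rV[R]_2).
Proof.
apply/matrixP => i j; rewrite mxE ord1 /dfun.
set c := chart_at x; have cx : cdom c x by exact: chart_at_dom.
have oc : open (cdom c) by exact: cdom_open.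
rewrite (@near_eq_derive _ _ _ _ (fun q : 'rV[R]_2 => q 0 j : R^o)).
  rewrite (_ : (fun q : 'rV[R]_2 => q 0 j : R^o) = fun q => (id q) 0 j)//.
  have dI : derivable (@id 'rV[R]_2) (cmap c x) v by exact: derivable_id.
  have := derive_mx dI.
  by rewrite derive_id => /matrixP /(_ 0 j); rewrite mxE.
by apply: filterS (near_chart oc cx cx) => q [_ _ /=->].
Qed.

(** The derivative of f along X is sum_i X^i d_i f in a fixed chart, and
    the Leibniz rule differentiates it once more. *)
Lemma dfun_vf U f (X : forall x : M, TM x) x (v : TM x) :
  open U -> smooth_fun U f -> smooth_vf U X -> U x ->
  let c := chart_at x in
  let ft : 'rV[R]_2 -> R^o := f \o cinv c in
  derivable_fun (fun y => dfun f (X y)) v /\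
  dfun (fun y => dfun f (X y)) v
  = \sum_(i < 2) (dfun (fun y => tcoord c (X y) 0 i) v
                    * 'D_(stdv i) ft (cmap c x)
                  + (X x : 'rV[R]_2) 0 i * 'D_v ('D_(stdv i) ft) (cmap c x)).
Proof.
move=> oU sf sX Ux c ft.
have ac : atlas c by exact: chart_at_atlas.
have cx : cdom c x by exact: chart_at_dom.
have oc : open (cdom c) by exact: cdom_open.
have nW := near_chart_img oU Ux cx; have Wx := nbhs_singleton nW.
have sft := sf c ac.
pose Xi i : 'rV[R]_2 -> R^o := (fun y => tcoord c (X y) 0 i) \o cinv c.
pose Di i : 'rV[R]_2 -> R^o := 'D_(stdv i) ft.
pose h : 'rV[R]_2 -> R^o := \sum_(i < 2) (Xi i * Di i).
have dX i : derivable (Xi i) (cmap c x) v.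
  have := sX c ac i c ac.
  rewrite -setIA setIid => sXi.
  by have [d _ _] := smooth_on_diff 0 0 sXi Wx; exact: diff_derivable.
have dD i : derivable (Di i) (cmap c x) v.
  by have [_ d _] := smooth_on_diff (stdv i) 0 sft Wx; exact: diff_derivable.
have dXD i : derivable (Xi i * Di i) (cmap c x) v by exact: derivableM.
have hE : \forall q \near cmap c x,
    h q = ((fun y => dfun f (X y)) \o cinv c) q.
  have oUc : open (U `&` cdom c) by exact: openI.
  have := near_chart oUc (conj Ux cx) cx; apply: filterS => q [[Uq _] cq qq].
  rewrite /= (dfun_chart _ oU sf ac Uq cq) derive_stdv.
    by rewrite /h fct_sumE qq.
  have [] // := smooth_on_diff 0 0 sft (p := cmap c (cinv c q)).
  by exists (cinv c q).
split.
  by apply: near_eq_derivable hE _; exact: derivable_sum.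
rewrite /dfun -(near_eq_derive _ hE) derive_sum//.
apply: eq_bigr => i _; rewrite deriveM// addrC; congr (_ + _).
  by rewrite mulrC.
by rewrite /Xi /= cmapK// tcoord_chart_at.
Qed.

(** The coordinate computation behind [X, Y] f = X (Y f) - Y (X f): the
    terms with the symmetric Hessian S cancel. *)
Lemma sum_lie_bracket (a b X Y D : 'I_2 -> R) (S : 'I_2 -> 'I_2 -> R) :
  (forall i j, S i j = S j i) ->
  \sum_(i < 2) (a i - b i) * D i
  = \sum_(i < 2) (a i * D i + Y i * \sum_(j < 2) X j * S i j)
    - \sum_(i < 2) (b i * D i + X i * \sum_(j < 2) Y j * S i j).
Proof.
move=> Ssym; rewrite !big_ord_recl !big_ord0 (Ssym (lift ord0 ord0)).
ring.
Qed.

(** This is d (df) = 0 evaluated on X and Y. *)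
Lemma dfun_bracket U f (X Y : forall x : M, TM x) x :
  open U -> smooth_fun U f -> smooth_vf U X -> smooth_vf U Y -> U x ->
  dfun f (lie_bracket X Y x)
  = dfun (fun y => dfun f (Y y)) (X x) - dfun (fun y => dfun f (X y)) (Y x).
Proof.
move=> oU sf sX sY Ux.
have [_ ->] := dfun_vf (X x) oU sf sY Ux.
have [_ ->] := dfun_vf (Y x) oU sf sX Ux.
set c := chart_at x; set ft := f \o cinv c.
have cx : cdom c x by exact: chart_at_dom.
have nW := near_chart_img oU Ux cx; have Wx := nbhs_singleton nW.
have sft := sf c (chart_at_atlas x).
have DE i (v : 'rV[R]_2) : 'D_v ('D_(stdv i) ft) (cmap c x)
    = \sum_(j < 2) v 0 j * 'D_(stdv j) ('D_(stdv i) ft) (cmap c x).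
  by apply: derive_stdv; have [_ d _] := smooth_on_diff (stdv i) 0 sft Wx.
have dft : differentiable ft (cmap c x).
  by have [] := smooth_on_diff 0 0 sft Wx.
rewrite [LHS](derive_stdv _ dft).
under [X in _ = X - _]eq_bigr do rewrite DE.
under [X in _ = _ - X]eq_bigr do rewrite DE.
under [LHS]eq_bigr => i _ do [rewrite /lie_bracket; rewrite mxE].
apply: sum_lie_bracket => i j.
exact: smooth_on_derive_swap sft nW.
Qed.

End Surface.

(** * Quaternion calculus *)

Section Quaternions.
Local Open Scope cquat_scope.
Context {R : realType}.
Local Notation H := 'rV[R[i]]_4.
Implicit Types (p q r s : H) (a b c d : R[i]).

Lemma q0_mkq a b c d : q0 (mkq a b c d) = a.
Proof. by rewrite /q0 mxE inordK. Qed.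
Lemma q1_mkq a b c d : q1 (mkq a b c d) = b.
Proof. by rewrite /q1 mxE inordK. Qed.
Lemma q2_mkq a b c d : q2 (mkq a b c d) = c.
Proof. by rewrite /q2 mxE inordK. Qed.
Lemma q3_mkq a b c d : q3 (mkq a b c d) = d.
Proof. by rewrite /q3 mxE inordK. Qed.

Lemma q0D p q : q0 (p + q) = q0 p + q0 q. Proof. by rewrite /q0 mxE. Qed.
Lemma q1D p q : q1 (p + q) = q1 p + q1 q. Proof. by rewrite /q1 mxE. Qed.
Lemma q2D p q : q2 (p + q) = q2 p + q2 q. Proof. by rewrite /q2 mxE. Qed.
Lemma q3D p q : q3 (p + q) = q3 p + q3 q. Proof. by rewrite /q3 mxE. Qed.

Lemma q0N p : q0 (- p) = - q0 p. Proof. by rewrite /q0 mxE. Qed.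
Lemma q1N p : q1 (- p) = - q1 p. Proof. by rewrite /q1 mxE. Qed.
Lemma q2N p : q2 (- p) = - q2 p. Proof. by rewrite /q2 mxE. Qed.
Lemma q3N p : q3 (- p) = - q3 p. Proof. by rewrite /q3 mxE. Qed.

Lemma q0Z a p : q0 (a *: p) = a * q0 p. Proof. by rewrite /q0 mxE. Qed.
Lemma q1Z a p : q1 (a *: p) = a * q1 p. Proof. by rewrite /q1 mxE. Qed.
Lemma q2Z a p : q2 (a *: p) = a * q2 p. Proof. by rewrite /q2 mxE. Qed.
Lemma q3Z a p : q3 (a *: p) = a * q3 p. Proof. by rewrite /q3 mxE. Qed.

Lemma q00 : q0 (0 : H) = 0. Proof. by rewrite /q0 mxE. Qed.
Lemma q10 : q1 (0 : H) = 0. Proof. by rewrite /q1 mxE. Qed.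
Lemma q20 : q2 (0 : H) = 0. Proof. by rewrite /q2 mxE. Qed.
Lemma q30 : q3 (0 : H) = 0. Proof. by rewrite /q3 mxE. Qed.

Definition quatE := (q0_mkq, q1_mkq, q2_mkq, q3_mkq, q0D, q1D, q2D, q3D,
  q0N, q1N, q2N, q3N, q0Z, q1Z, q2Z, q3Z, (q00, q10, q20, q30)).

(** Together with the component rules [quatE] this reduces identities
    between quaternions to ring identities between complex numbers. *)
Lemma quatP p q : q0 p = q0 q -> q1 p = q1 q -> q2 p = q2 q -> q3 p = q3 q ->
  p = q.
Proof.
move=> e0 e1 e2 e3; apply/rowP => j; rewrite -[j]inord_val.
by case: j => [[|[|[|[|]]]]].
Qed.

Lemma qmulA p q r : p ** (q ** r) = p ** q ** r.
Proof. by apply: quatP; rewrite /qmul !quatE; ring. Qed.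

Lemma qmul1q p : qone ** p = p.
Proof. by apply: quatP; rewrite /qmul /qone !quatE; ring. Qed.

Lemma qmulq1 p : p ** qone = p.
Proof. by apply: quatP; rewrite /qmul /qone !quatE; ring. Qed.

Lemma qmulDl p q r : (p + q) ** r = p ** r + q ** r.
Proof. by apply: quatP; rewrite /qmul !quatE; ring. Qed.

Lemma qmulDr p q r : p ** (q + r) = p ** q + p ** r.
Proof. by apply: quatP; rewrite /qmul !quatE; ring. Qed.

Lemma qmulNl p q : (- p) ** q = - (p ** q).
Proof. by apply: quatP; rewrite /qmul !quatE; ring. Qed.

Lemma qmulNr p q : p ** (- q) = - (p ** q).
Proof. by apply: quatP; rewrite /qmul !quatE; ring. Qed.

Lemma qmulZl a p q : (a *: p) ** q = a *: (p ** q).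
Proof. by apply: quatP; rewrite /qmul !quatE; ring. Qed.

Lemma qmulZr a p q : p ** (a *: q) = a *: (p ** q).
Proof. by apply: quatP; rewrite /qmul !quatE; ring. Qed.

Lemma qbarM p q : qbar (p ** q) = qbar q ** qbar p.
Proof. by apply: quatP; rewrite /qbar /qmul !quatE; ring. Qed.

Lemma qbarD p q : qbar (p + q) = qbar p + qbar q.
Proof. by apply: quatP; rewrite /qbar !quatE; ring. Qed.

Lemma qmul_bar p : p ** qbar p = qH p p *: qone.
Proof. by apply: quatP; rewrite /qmul /qbar /qone /qH !quatE; ring. Qed.

Lemma qbar_mul p : qbar p ** p = qH p p *: qone.
Proof. by apply: quatP; rewrite /qmul /qbar /qone /qH !quatE; ring. Qed.

Lemma qhatM p q : qhat (p ** q) = qhat p ** qhat q.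
Proof.
by apply: quatP; rewrite /qhat /qmul !quatE !(rmorphD, rmorphN, rmorphM).
Qed.

Lemma qhatD p q : qhat (p + q) = qhat p + qhat q.
Proof. by apply: quatP; rewrite /qhat !quatE rmorphD. Qed.

Lemma qhatK p : qhat (qhat p) = p.
Proof. by apply: quatP; rewrite /qhat !quatE conjcK. Qed.

Lemma qhat_bar p : qhat (qbar p) = qbar (qhat p).
Proof. by apply: quatP; rewrite /qhat /qbar !quatE ?rmorphN. Qed.

Lemma qhat_one : qhat qone = qone :> H.
Proof. by apply: quatP; rewrite /qhat /qone !quatE ?rmorph0 ?rmorph1. Qed.
Lemma qhat_I : qhat qI = qI :> H.
Proof. by apply: quatP; rewrite /qhat /qI !quatE ?rmorph0 ?rmorph1. Qed.
Lemma qhat_J : qhat qJ = qJ :> H.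
Proof. by apply: quatP; rewrite /qhat /qJ !quatE ?rmorph0 ?rmorph1. Qed.
Lemma qhat_K : qhat qK = qK :> H.
Proof. by apply: quatP; rewrite /qhat /qK !quatE ?rmorph0 ?rmorph1. Qed.

Lemma qmulJK : qJ ** qK = qI :> H.
Proof. by apply: quatP; rewrite /qmul /qI /qJ /qK !quatE; ring. Qed.
Lemma qmulKJ : qK ** qJ = - qI :> H.
Proof. by apply: quatP; rewrite /qmul /qI /qJ /qK !quatE; ring. Qed.

End Quaternions.

(** * Geometry of the complex quadric *)

Section Quadric.
Local Open Scope cquat_scope.
Context {R : realType}.
Local Notation H := 'rV[R[i]]_4.
Implicit Types (p q u v w psi A B : H).

Lemma q0_mul_bar p q : q0 (p ** qbar q) = qH p q.
Proof. rewrite /qmul /qbar /qH !quatE; ring. Qed.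

Lemma qH_sym p q : qH p q = qH q p.
Proof. rewrite /qH; ring. Qed.

Lemma qcrossE v w : qcross v w =
  mkq 0 (q2 v * q3 w - q3 v * q2 w) (q3 v * q1 w - q1 v * q3 w)
        (q1 v * q2 w - q2 v * q1 w).
Proof. by apply: quatP; rewrite /qcross /qmul !quatE; field. Qed.

Lemma qH_conj psi u v : qH psi psi = 1 ->
  qH (qbar psi ** u ** psi) (qbar psi ** v ** psi) = qH u v.
Proof.
move=> n1.
have -> : qH (qbar psi ** u ** psi) (qbar psi ** v ** psi)
  = qH psi psi * qH psi psi * qH u v.
  rewrite /qH /qmul /qbar !quatE; ring.
by rewrite n1 !mul1r.
Qed.

(** Since psi qbar psi = 1, conjugation by psi is an algebra
    automorphism. *)
Lemma qcross_conj psi u v : qH psi psi = 1 ->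
  qcross (qbar psi ** u ** psi) (qbar psi ** v ** psi)
  = qbar psi ** qcross u v ** psi.
Proof.
move=> n1.
have E w z : qbar psi ** w ** psi ** (qbar psi ** z ** psi)
           = qbar psi ** (w ** z) ** psi.
  rewrite -!qmulA [psi ** (_ ** _)]qmulA qmul_bar n1 scale1r qmul1q.
  by rewrite !qmulA.
by rewrite /qcross (E u v) (E v u) qmulZr qmulZl qmulDr qmulDl qmulNr qmulNl.
Qed.

Lemma omegaQ_conj psi p v w : qH psi psi = 1 ->
  omegaQ (qbar psi ** p ** psi) (qbar psi ** v ** psi) (qbar psi ** w ** psi)
  = omegaQ p v w.
Proof. by move=> n1; rewrite /omegaQ qcross_conj// qH_conj. Qed.

(** The derivative of psi |-> qbar psi ** I ** psi in the direction A. *)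
Definition dgauss psi A := qbar A ** qI ** psi + qbar psi ** qI ** A.

Lemma dgauss_linear psi (a : R[i]) A B :
  dgauss psi (a *: A + B) = a *: dgauss psi A + dgauss psi B.
Proof.
have qbarZ q : qbar (a *: q) = a *: qbar q.
  by apply: quatP; rewrite /qbar !quatE ?mulrN.
rewrite /dgauss qbarD qbarZ !qmulDl !qmulDr !qmulZl qmulZr scalerDr.
exact: addrACA.
Qed.

(** With a = A psi^-1, which is imaginary as A is tangent to the quadric
    H(psi, psi) = 1, the derivative is psi^-1 (I a - a I) psi, and the
    commutator with I only sees the J and K components of a. *)
Lemma dgaussE psi A : qH psi psi = 1 -> qH A psi = 0 ->
  dgauss psi A = qbar psi **
    mkq 0 0 (- 2 * q3 (A ** qbar psi)) (2 * q2 (A ** qbar psi)) ** psi.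
Proof.
move=> n1 nA; set a := A ** qbar psi.
have EA : A = a ** psi by rewrite -qmulA qbar_mul n1 scale1r qmulq1.
have a0 : q0 a = 0 by rewrite q0_mul_bar.
clearbody a.
have -> : dgauss psi A = qbar (a ** psi) ** qI ** psi
                       + qbar psi ** qI ** (a ** psi) by rewrite -EA.
rewrite qbarM -!qmulA -qmulDr; congr (_ ** _).
rewrite !qmulA -qmulDl; congr (_ ** _).
by apply: quatP; rewrite /qmul /qbar /qI !quatE ?a0; ring.
Qed.

(** With a = A psi^-1 and b = B psi^-1 both sides equal
    4 (a2 b3 - a3 b2): the left one by [dgaussE], the right one because
    B qbar A - A qbar B = a b - b a. *)
Lemma omegaQ_dgauss psi A B :
  qH psi psi = 1 -> qH A psi = 0 -> qH B psi = 0 ->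
  omegaQ (qbar psi ** qI ** psi) (dgauss psi A) (dgauss psi B)
  = 2 * (q1 (B ** qbar A) - q1 (A ** qbar B)).
Proof.
move=> n1 nA nB; rewrite !dgaussE// omegaQ_conj//.
set a := A ** qbar psi; set b := B ** qbar psi.
have EA : A = a ** psi by rewrite -qmulA qbar_mul n1 scale1r qmulq1.
have EB : B = b ** psi by rewrite -qmulA qbar_mul n1 scale1r qmulq1.
have a0 : q0 a = 0 by rewrite q0_mul_bar.
have b0 : q0 b = 0 by rewrite q0_mul_bar.
clearbody a b.
have E c d : c ** psi ** qbar (d ** psi) = c ** qbar d.
  by rewrite qbarM -qmulA (qmulA psi) qmul_bar n1 scale1r qmul1q.
rewrite [in RHS]EA [in RHS]EB !E.
rewrite /omegaQ qcrossE /qH /qmul /qbar /qI !quatE a0 b0.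
ring.
Qed.

Lemma tangentQ_dgauss psi A : qH psi psi = 1 -> qH A psi = 0 ->
  tangentQ (qbar psi ** qI ** psi) (dgauss psi A).
Proof.
move=> n1 nA; split; last first.
  by rewrite dgaussE// qH_conj// /qH /qI !quatE; ring.
by rewrite /dgauss /qmul /qbar /qI !quatE; ring.
Qed.

Lemma omegaQ_bilinear p v w (a b c d : R[i]) :
  omegaQ p (a *: v + b *: w) (c *: v + d *: w)
  = (a * d - b * c) * omegaQ p v w.
Proof. rewrite /omegaQ !qcrossE /qH !quatE; ring. Qed.

(** The rule u x (v x w) = (u . w) v - (u . v) w of vector calculus. *)
Lemma qcross_qcross p v w : q0 v = 0 -> q0 w = 0 ->  q0 p = 0 ->
  qcross p (qcross v w) = qH w p *: v - qH v p *: w.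
Proof.
move=> v0 w0 p0.
by apply: quatP; rewrite !qcrossE /qH !quatE v0 w0 ?p0; ring.
Qed.

(** The vector v x w is orthogonal to v and w, hence p x (v x w) = 0 when
    v and w are tangent at p; as H(p, p) = 1, applying p x _ once more shows
    that v x w is its own projection on p. *)
Lemma qcross_tangent p v w : q0 p = 0 -> qH p p = 1 ->
  tangentQ p v -> tangentQ p w -> qcross v w = omegaQ p v w *: p.
Proof.
move=> p0 p1 [v0 vp] [w0 wp]; rewrite /omegaQ.
have u0 : q0 (qcross v w) = 0 by rewrite qcrossE !quatE.
have := qcross_qcross p0 u0 p0.
rewrite (qcross_qcross v0 w0 p0) vp wp !scale0r subrr p1 scale1r.
have -> : qcross p 0 = 0 by rewrite qcrossE; apply: quatP; rewrite !quatE; ring.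
by move/eqP; rewrite eq_sym subr_eq0 => /eqP.
Qed.

Lemma qcross_eq0 v w : q0 v = 0 -> q0 w = 0 -> qcross v w = 0 ->
  v != 0 -> exists a, w = a *: v.
Proof.
move=> v0 w0 vw nv.
have [e1 e2 e3] : [/\ q2 v * q3 w = q3 v * q2 w, q3 v * q1 w = q1 v * q3 w
    & q1 v * q2 w = q2 v * q1 w].
  move: vw; rewrite qcrossE => vw.
  by split; apply/eqP; rewrite -subr_eq0; apply/eqP;
    [have := congr1 q1 vw|have := congr1 q2 vw|have := congr1 q3 vw];
    rewrite !quatE.
have K x y a b : x != 0 -> x * b = a * y -> b = y / x * a :> R[i].
  by move=> nx e; rewrite mulrAC [y * a]mulrC -e mulrC mulKf.
have [v1|n1] := eqVneq (q1 v) 0; last first.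
  by exists (q1 w / q1 v); apply: quatP; rewrite !quatE ?v0 ?w0 ?mulr0//;
    apply: K => //; exact: esym.
have [v2|n2] := eqVneq (q2 v) 0; last first.
  by exists (q2 w / q2 v); apply: quatP; rewrite !quatE ?v0 ?w0 ?mulr0//;
    apply: K => //; exact: esym.
have [v3|n3] := eqVneq (q3 v) 0; last first.
  by exists (q3 w / q3 v); apply: quatP; rewrite !quatE ?v0 ?w0 ?mulr0//;
    apply: K => //; exact: esym.
by case/eqP: nv; apply: quatP; rewrite ?quatE.
Qed.

Lemma tangentQ_nonzero p : qH p p = 1 -> q0 p = 0 ->
  exists2 u, u != 0 & tangentQ p u.
Proof.
move=> p1 p0.
(* (0, p2, -p1, 0) is orthogonal to p; it vanishes only if p = p3 K, and then
   I is orthogonal to p. *)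
have [p12|n12] := eqVneq (mkq 0 (q2 p) (- q1 p) 0) 0; last first.
  exists (mkq 0 (q2 p) (- q1 p) 0) => //; split; first by rewrite quatE.
  rewrite /qH !quatE; ring.
exists qI; last split; rewrite ?/qH /qI ?quatE//.
  apply/eqP => /(congr1 q1); rewrite !quatE => /eqP; by rewrite oner_eq0.
have := congr1 q2 p12; rewrite !quatE => /eqP; rewrite oppr_eq0 => /eqP->.
by ring.
Qed.

(** By [qcross_tangent] the vanishing of the area form amounts to that of
    v x w, that is, to v and w being proportional. If both are 0, any line of
    the tangent plane contains them. *)
Lemma omegaQ_eq0_line p v w : q0 p = 0 -> qH p p = 1 ->
  tangentQ p v -> tangentQ p w ->
  omegaQ p v w = 0 <->
  exists L : {vspace H},
    [/\ \dim L = 1%N, [set` L] `<=` tangentQ p, v \in L & w \in L].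
Proof.
move=> p0 p1 tv tw.
have lineP u : u != 0 -> tangentQ p u ->
    \dim <[u]> = 1%N /\ [set` <[u]>%VS] `<=` tangentQ p.
  move=> nu [u0 up]; split; first by rewrite dim_vline nu.
  move=> z /vlineP[a ->]; split; first by rewrite quatE u0 mulr0.
  have -> : qH (a *: u) p = a * qH u p by rewrite /qH !quatE; ring.
  by rewrite up mulr0.
split=> [om0|[L [dL _ vL wL]]].
  have vw : qcross v w = 0 by rewrite (qcross_tangent p0 p1 tv tw) om0 scale0r.
  have [v0|nv] := eqVneq v 0; last first.
    have [a wE] := qcross_eq0 tv.1 tw.1 vw nv.
    have [dL sL] := lineP v nv tv.
    by exists <[v]>%VS; split=> //; rewrite ?memv_line// wE memvZ// memv_line.
  have [w0|nw] := eqVneq w 0; last first.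
    have [dL sL] := lineP w nw tw.
    by exists <[w]>%VS; split=> //; rewrite ?memv_line// v0 mem0v.
  have [u nu tu] := tangentQ_nonzero p1 p0.
  have [dL sL] := lineP u nu tu.
  by exists <[u]>%VS; split=> //; rewrite ?v0 ?w0 mem0v.
have nL : vpick L != 0 by rewrite vpick0 -dimv_eq0 dL.
(* a line is spanned by any of its nonzero vectors *)
have LE : L = <[vpick L]>%VS.
  apply/eqP; rewrite eq_sym eqEdim dim_vline nL dL andbT.
  by rewrite -memvE memv_pick.
move: vL wL; rewrite LE => /vlineP[a ->] /vlineP[b ->].
rewrite /omegaQ qcrossE /qH !quatE; ring.
Qed.

End Quadric.

(** * The Dirac equation in one fibre *)

Section DiracAlgebra.
Local Open Scope cquat_scope.
Context {R : realType}.
Local Notation H := 'rV[R[i]]_4.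
Implicit Types (A B h psi : H).

Lemma mink_one : mink 1 0 0 0 = 'i *: qone :> H.
Proof. by apply: quatP; rewrite /mink /qone !quatE ?mulr0 ?mulr1. Qed.
Lemma mink_I : mink 0 1 0 0 = qI :> H.
Proof. by apply: quatP; rewrite /mink /qI !quatE ?mulr0. Qed.
Lemma mink_J : mink 0 0 1 0 = qJ :> H.
Proof. by apply: quatP; rewrite /mink /qJ !quatE ?mulr0. Qed.
Lemma mink_K : mink 0 0 0 1 = qK :> H.
Proof. by apply: quatP; rewrite /mink /qK !quatE ?mulr0. Qed.

(** The Dirac equation for psi with derivatives A and B along e2 and e3,
    where h in C + C I is the coordinate of the mean curvature vector. Taking
    qhat and multiplying by psi^-1 gives
    J (A psi^-1 + a I) + K (B psi^-1 + b I) = qhat h. As A psi^-1 and B psi^-1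
    have no scalar part, the K component only involves the I component of the
    first bracket and the J component that of the second one; qhat h has
    neither component. *)
Lemma dirac_components psi A B h (a b : R[i]) :
  qH psi psi = 1 -> qH A psi = 0 -> qH B psi = 0 -> q2 h = 0 -> q3 h = 0 ->
  qJ ** qhat (A + a *: (qI ** psi)) + qK ** qhat (B + b *: (qI ** psi))
    = h ** qhat psi ->
  q1 (A ** qbar psi) = - a /\ q1 (B ** qbar psi) = - b.
Proof.
move=> n1 nA nB h2 h3 /(congr1 qhat).
rewrite qhatD !qhatM !qhatK qhat_J qhat_K => /(congr1 (fun q => q ** qbar psi)).
rewrite qmulDl -!qmulA qmul_bar n1 scale1r qmulq1 !qmulDl !qmulZl.
rewrite -!qmulA qmul_bar n1 scale1r qmulq1.
have A0 : q0 (A ** qbar psi) = 0 by rewrite q0_mul_bar.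
have B0 : q0 (B ** qbar psi) = 0 by rewrite q0_mul_bar.
move: A0 B0; move: (A ** qbar psi) (B ** qbar psi) => {nA nB}A {}B A0 B0 E.
have := congr1 q2 E; have := congr1 q3 E.
rewrite /qmul /qhat /qI /qJ /qK !quatE A0 B0 h2 h3 rmorph0 => E3 E2.
split; apply/eqP; rewrite -addr_eq0; apply/eqP.
  by rewrite -[RHS]oppr0 -E3; ring.
by rewrite -E2; ring.
Qed.

End DiracAlgebra.

(** * Derivatives of quaternion-valued functions *)

Section ComplexDerivations.
Local Open Scope cquat_scope.
Context {R : realType} {M : oriented_surface R}.
Implicit Types (U : set M).

Definition dc (f : M -> R[i]) (x : M) (v : TM x) : R[i] :=
  dfun (fun y => complex.Re (f y)) v +i* dfun (fun y => complex.Im (f y)) v.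

(** A relational form, carrying differentiability along v, so that the
    differentiation rules compose without side conditions. *)
Definition is_dc (f : M -> R[i]) (x : M) (v : TM x) (d : R[i]) : Prop :=
  [/\ derivable_fun (fun y => complex.Re (f y)) v,
      derivable_fun (fun y => complex.Im (f y)) v & dc f v = d].

Lemma eq_dc U (f g : M -> R[i]) x (v : TM x) : open U -> U x ->
  (forall y, U y -> f y = g y) -> dc f v = dc g v.
Proof.
move=> oU Ux fg.
by congr (_ +i* _); apply: (eq_dfun _ oU Ux) => y /fg ->.
Qed.

Lemma dc_cst (k : R[i]) (x : M) (v : TM x) : dc (fun _ : M => k) v = 0.
Proof. by rewrite /dc !dfun_cst. Qed.

Lemma is_dcD (f g : M -> R[i]) x (v : TM x) a b : is_dc f v a -> is_dc g v b ->
  is_dc (fun y => f y + g y) v (a + b).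
Proof.
move=> [rf mf <-] [rg mg <-].
have ReE : (fun y => complex.Re (f y + g y))
    = (fun y => complex.Re (f y) + complex.Re (g y)).
  by apply/funext => y; case: (f y) => ? ?; case: (g y).
have ImE : (fun y => complex.Im (f y + g y))
    = (fun y => complex.Im (f y) + complex.Im (g y)).
  by apply/funext => y; case: (f y) => ? ?; case: (g y).
split; rewrite /dc ?ReE ?ImE; [exact: derivable_funD..|].
by rewrite !dfunD.
Qed.

Lemma is_dcN (f : M -> R[i]) x (v : TM x) a : is_dc f v a ->
  is_dc (fun y => - f y) v (- a).
Proof.
move=> [rf mf <-].
have ReE : (fun y => complex.Re (- f y)) = (fun y => - complex.Re (f y)).
  by apply/funext => y; case: (f y).
have ImE : (fun y => complex.Im (- f y)) = (fun y => - complex.Im (f y)).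
  by apply/funext => y; case: (f y).
split; rewrite /dc ?ReE ?ImE; [exact: derivable_funN..|].
by rewrite !dfunN.
Qed.

Lemma is_dcM (f g : M -> R[i]) x (v : TM x) a b : is_dc f v a -> is_dc g v b ->
  is_dc (fun y => f y * g y) v (a * g x + f x * b).
Proof.
move=> [rf mf <-] [rg mg <-].
pose fr y := complex.Re (f y); pose fi y := complex.Im (f y).
pose gr y := complex.Re (g y); pose gi y := complex.Im (g y).
have ReE : (fun y => complex.Re (f y * g y))
    = (fun y => fr y * gr y + - (fi y * gi y)).
  by apply/funext => y; rewrite /fr /fi /gr /gi; case: (f y) => ? ?; case: (g y).
have ImE : (fun y => complex.Im (f y * g y))
    = (fun y => fr y * gi y + fi y * gr y).
  by apply/funext => y; rewrite /fr /fi /gr /gi; case: (f y) => ? ?; case: (g y).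
have hrr : derivable_fun (fun y => fr y * gr y) v := derivable_funM rf rg.
have hii : derivable_fun (fun y => fi y * gi y) v := derivable_funM mf mg.
have hri : derivable_fun (fun y => fr y * gi y) v := derivable_funM rf mg.
have hir : derivable_fun (fun y => fi y * gr y) v := derivable_funM mf rg.
split; rewrite /dc ?ReE ?ImE.
- exact: derivable_funD hrr (derivable_funN hii).
- exact: derivable_funD hri hir.
rewrite (dfunD hrr (derivable_funN hii)) (dfunN hii) (dfunD hri hir).
rewrite (dfunM rf rg) (dfunM mf mg) (dfunM rf mg) (dfunM mf rg).
rewrite -/fr -/fi -/gr -/gi.
have -> : f x = fr x +i* fi x by rewrite /fr /fi; case: (f x).
have -> : g x = gr x +i* gi x by rewrite /gr /gi; case: (g x).
by apply/eqP; rewrite eq_complex; apply/andP; split; apply/eqP => /=; ring.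
Qed.

Definition is_dq (f : M -> 'rV[R[i]]_4) (x : M) (v : TM x) (D : 'rV[R[i]]_4) :=
  forall j, is_dc (fun y => f y 0 j) v (D 0 j).

Lemma is_dqE (f : M -> 'rV[R[i]]_4) x (v : TM x) D : is_dq f v D -> dq f v = D.
Proof. by move=> h; apply/rowP => j; rewrite mxE; have [_ _] := h j. Qed.

Lemma eq_dq U (f g : M -> 'rV[R[i]]_4) x (v : TM x) : open U -> U x ->
  (forall y, U y -> f y = g y) -> dq f v = dq g v.
Proof.
move=> oU Ux fg; apply/rowP => j; rewrite !mxE.
by apply: (eq_dc _ oU Ux) => y /fg ->.
Qed.

Lemma is_dq_mkq (a b c d : M -> R[i]) x (v : TM x) a' b' c' d' :
  is_dc a v a' -> is_dc b v b' -> is_dc c v c' -> is_dc d v d' ->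
  is_dq (fun y => mkq (a y) (b y) (c y) (d y)) v (mkq a' b' c' d').
Proof.
move=> ha hb hc hd j; rewrite mxE.
under [fun y => _]eq_fun do rewrite mxE.
by case: j => [[|[|[|[|]]]]].
Qed.

Lemma is_dq_mul (f g : M -> 'rV[R[i]]_4) x (v : TM x) A B :
  is_dq f v A -> is_dq g v B ->
  is_dq (fun y => f y ** g y) v (A ** g x + f x ** B).
Proof.
move=> hf hg.
pose P i j : is_dc (fun y => f y 0 i * g y 0 j) v _ := is_dcM (hf i) (hg j).
have h := is_dq_mkq
 (is_dcD (is_dcD (is_dcD (P (inord 0) (inord 0))
    (is_dcN (P (inord 1) (inord 1)))) (is_dcN (P (inord 2) (inord 2))))
    (is_dcN (P (inord 3) (inord 3))))
 (is_dcD (is_dcD (is_dcD (P (inord 0) (inord 1)) (P (inord 1) (inord 0)))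
    (P (inord 2) (inord 3))) (is_dcN (P (inord 3) (inord 2))))
 (is_dcD (is_dcD (is_dcD (P (inord 0) (inord 2))
    (is_dcN (P (inord 1) (inord 3)))) (P (inord 2) (inord 0)))
    (P (inord 3) (inord 1)))
 (is_dcD (is_dcD (is_dcD (P (inord 0) (inord 3)) (P (inord 1) (inord 2)))
    (is_dcN (P (inord 2) (inord 1)))) (P (inord 3) (inord 0))).
move: h; set D := mkq _ _ _ _; suff -> : D = A ** g x + f x ** B by [].
rewrite /D -/(q0 A) -/(q1 A) -/(q2 A) -/(q3 A) -/(q0 B) -/(q1 B) -/(q2 B).
rewrite -/(q3 B) -/(q0 (f x)) -/(q1 (f x)) -/(q2 (f x)) -/(q3 (f x)).
rewrite -/(q0 (g x)) -/(q1 (g x)) -/(q2 (g x)) -/(q3 (g x)).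
by apply: quatP; rewrite /qmul !quatE; ring.
Qed.

Lemma is_dq_bar (f : M -> 'rV[R[i]]_4) x (v : TM x) A :
  is_dq f v A -> is_dq (fun y => qbar (f y)) v (qbar A).
Proof.
move=> hf; exact: is_dq_mkq (hf (inord 0)) (is_dcN (hf (inord 1)))
  (is_dcN (hf (inord 2))) (is_dcN (hf (inord 3))).
Qed.

Lemma is_dq_cst (k : 'rV[R[i]]_4) (x : M) (v : TM x) :
  is_dq (fun _ : M => k) v 0.
Proof.
move=> j; split; rewrite ?mxE ?dc_cst//; exact: derivable_cst.
Qed.

Lemma is_dq_smooth U (f : M -> 'rV[R[i]]_4) x (v : TM x) :
  open U -> smooth_q U f -> U x -> is_dq f v (dq f v).
Proof.
move=> oU sf Ux j; have [sr si] := sf j.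
by split; rewrite ?mxE//; [exact: smooth_derivable sr Ux|
  exact: smooth_derivable si Ux].
Qed.

Lemma dq_Re (f : M -> 'rV[R[i]]_4) (X : forall x : M, TM x) j :
  (fun y => complex.Re (dq f (X y) 0 j))
  = (fun y => dfun (fun z => complex.Re (f z 0 j)) (X y)).
Proof. by apply/funext => y; rewrite mxE. Qed.

Lemma dq_Im (f : M -> 'rV[R[i]]_4) (X : forall x : M, TM x) j :
  (fun y => complex.Im (dq f (X y) 0 j))
  = (fun y => dfun (fun z => complex.Im (f z 0 j)) (X y)).
Proof. by apply/funext => y; rewrite mxE. Qed.

Lemma is_dq_vf U (f : M -> 'rV[R[i]]_4) (X : forall x : M, TM x) x (v : TM x) :
  open U -> smooth_q U f -> smooth_vf U X -> U x ->
  is_dq (fun y => dq f (X y)) v (dq (fun y => dq f (X y)) v).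
Proof.
move=> oU sf sX Ux j; have [sr si] := sf j.
split; rewrite ?dq_Re ?dq_Im ?mxE//.
- by have [] := dfun_vf v oU sr sX Ux.
- by have [] := dfun_vf v oU si sX Ux.
Qed.

Lemma dq_linear U (f : M -> 'rV[R[i]]_4) x (a : R) (v w : TM x) :
  open U -> smooth_q U f -> U x ->
  dq f (a *: v + w) = a%:C *: dq f v + dq f w.
Proof.
move=> oU sf Ux; apply/rowP => j; have [sr si] := sf j; rewrite !mxE.
rewrite (dfun_linear a v w oU sr Ux) (dfun_linear a v w oU si Ux).
by apply/eqP; rewrite eq_complex; apply/andP; split; apply/eqP => /=; ring.
Qed.

Lemma dq_bracket U (f : M -> 'rV[R[i]]_4) (X Y : forall x : M, TM x) x :
  open U -> smooth_q U f -> smooth_vf U X -> smooth_vf U Y -> U x ->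
  dq f (lie_bracket X Y x)
  = dq (fun y => dq f (Y y)) (X x) - dq (fun y => dq f (X y)) (Y x).
Proof.
move=> oU sf sX sY Ux; apply/rowP => j; have [sr si] := sf j; rewrite !mxE.
rewrite (dfun_bracket oU sr sX sY Ux) (dfun_bracket oU si sX sY Ux).
by rewrite !dq_Re !dq_Im.
Qed.

Lemma is_dc_q1 (f : M -> 'rV[R[i]]_4) x (v : TM x) A :
  is_dq f v A -> is_dc (fun y => q1 (f y)) v (q1 A).
Proof. by move=> h; exact: h. Qed.

(** The I component of d alpha = alpha /\ alpha for alpha = dpsi qbar psi.
    Differentiating alpha(Y) along X leaves, next to second derivatives of psi
    that cancel by [dq_bracket], the product of dpsi(Y) with qbar (dpsi(X)). *)
Lemma maurer_cartan_I U (psi : M -> 'rV[R[i]]_4) (X Y : forall x : M, TM x) x :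
  open U -> smooth_q U psi -> smooth_vf U X -> smooth_vf U Y -> U x ->
  let dpsi_I y (v : TM y) := q1 (dq psi v ** qbar (psi y)) in
  let A := dq psi (X x) in let B := dq psi (Y x) in
  exists a b, [/\ is_dc (fun y => dpsi_I y (Y y)) (X x) a,
    is_dc (fun y => dpsi_I y (X y)) (Y x) b &
    a - b - dpsi_I x (lie_bracket X Y x) = q1 (B ** qbar A) - q1 (A ** qbar B)].
Proof.
move=> oU sp sX sY Ux dpsi_I A B.
have hb v := is_dq_bar (is_dq_smooth v oU sp Ux).
have hY := is_dq_vf (X x) oU sp sY Ux.
have hX := is_dq_vf (Y x) oU sp sX Ux.
exists (q1 (dq (fun y => dq psi (Y y)) (X x) ** qbar (psi x) + B ** qbar A)),
  (q1 (dq (fun y => dq psi (X y)) (Y x) ** qbar (psi x) + A ** qbar B)).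
split.
- by apply: is_dc_q1; exact: is_dq_mul (hY) (hb _).
- by apply: is_dc_q1; exact: is_dq_mul (hX) (hb _).
have L (a b c d : 'rV[R[i]]_4) :
    q1 (a + b) - q1 (c + d) - q1 (a - c) = q1 b - q1 d.
  by rewrite !q1D q1N; ring.
rewrite /dpsi_I (dq_bracket oU sp sX sY Ux) qmulDl qmulNl; exact: L.
Qed.

(** This is half of the derivative of the constant H(psi, psi). *)
Lemma qH_dq_eq0 U (psi : M -> 'rV[R[i]]_4) x (v : TM x) :
  open U -> smooth_q U psi -> (forall y, U y -> qH (psi y) (psi y) = 1) ->
  U x -> qH (dq psi v) (psi x) = 0.
Proof.
move=> oU sp n1 Ux.
have hp := is_dq_smooth v oU sp Ux.
have [_ _ E] := is_dq_mul hp (is_dq_bar hp) (inord 0).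
have : dc (fun y => (psi y ** qbar (psi y)) 0 (inord 0)) v = 0.
  rewrite -[RHS](dc_cst 1 v); apply: (eq_dc _ oU Ux) => y Uy.
  by rewrite -/(q0 _) q0_mul_bar n1.
rewrite E -/(q0 _) q0D !q0_mul_bar [qH (psi x) _]qH_sym => /eqP.
by rewrite -mulr2n mulrn_eq0 => /eqP.
Qed.

End ComplexDerivations.

(** * Metric connections on bundles of rank 2 *)

Section Rank2.
Context {R : realType} {V : lmodType R}.

Definition rank2 : Prop :=
  exists e f : V, forall w, exists a b : R, w = a *: e + b *: f.

Context (g : V -> V -> R)
  (glin : forall (a : R) (u v w : V), g (a *: u + v) w = a * g u w + g v w)
  (gsym : forall u v : V, g u v = g v u).

Lemma form0l w : g 0 w = 0.
Proof.
by have := glin (-1) 0 0 w; rewrite scaler0 addr0 mulN1r addNr.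
Qed.

Lemma formZl a u w : g (a *: u) w = a * g u w.
Proof. by have := glin a u 0 w; rewrite addr0 form0l addr0. Qed.

Lemma formDl u v w : g (u + v) w = g u w + g v w.
Proof. by have := glin 1 u v w; rewrite scale1r mul1r. Qed.

Lemma formNl u w : g (- u) w = - g u w.
Proof. by rewrite -scaleN1r formZl mulN1r. Qed.

(** By Cramer's rule, with D the determinant of (s, t) in a generating pair
    (e, f). If D = 0 the minors give linear relations between s and t, which
    orthogonality forces to be trivial. *)
Lemma rank2_basis s t : rank2 -> g s s != 0 -> g t t != 0 -> g s t = 0 ->
  forall w, exists a b : R, w = a *: s + b *: t.
Proof.
move=> [e [f ef]] ss tt st w.
have [a1 [b1 Es]] := ef s; have [a2 [b2 Et]] := ef t.
have [a3 [b3 Ew]] := ef w.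
pose D := a1 * b2 - b1 * a2.
have [D0|nD] := eqVneq D 0; last first.
  exists ((a3 * b2 - b3 * a2) / D), ((a1 * b3 - b1 * a3) / D).
  rewrite Ew Es Et !scalerDr !scalerA addrACA -!scalerDl.
  by congr (_ *: _ + _ *: _); rewrite /D; field.
(* s and t are independent, as they are orthogonal and not isotropic *)
have comb (x y : R) : x *: s + y *: t = 0 -> x = 0 /\ y = 0.
  move=> E.
  have Es' : g (x *: s + y *: t) s = 0 by rewrite E form0l.
  have Et' : g (x *: s + y *: t) t = 0 by rewrite E form0l.
  move: Es' Et'; rewrite !formDl !formZl st (gsym t s) st !mulr0 addr0 add0r.
  move=> /eqP + /eqP; rewrite !mulf_eq0 (negbTE ss) (negbTE tt) !orbF.
  by move=> /eqP-> /eqP->.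
have [a20 a10] : a2 = 0 /\ - a1 = 0.
  apply: comb; rewrite Es Et !scalerDr !scalerA addrACA -!scalerDl.
  have -> : a2 * a1 + - a1 * a2 = 0 by ring.
  have -> : a2 * b1 + - a1 * b2 = - D by rewrite /D; ring.
  by rewrite D0 oppr0 !scale0r addr0.
have [b20 b10] : b2 = 0 /\ - b1 = 0.
  apply: comb; rewrite Es Et !scalerDr !scalerA addrACA -!scalerDl.
  have -> : b2 * b1 + - b1 * b2 = 0 by ring.
  have -> : b2 * a1 + - b1 * a2 = D by rewrite /D; ring.
  by rewrite D0 !scale0r addr0.
case/eqP: ss; rewrite Es; move/eqP: a10; move/eqP: b10.
by rewrite !oppr_eq0 => /eqP-> /eqP->; rewrite !scale0r addr0 form0l.
Qed.

Lemma rank2_coords s t : rank2 -> g s s != 0 -> g t t != 0 -> g s t = 0 ->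
  forall w, w = (g w s / g s s) *: s + (g w t / g t t) *: t.
Proof.
move=> r2 ss tt st w; have [a [b ->]] := rank2_basis r2 ss tt st w.
by rewrite !formDl !formZl st (gsym t s) st !mulr0 addr0 add0r !mulfK.
Qed.

(** The vector w is a multiple of t, since it is orthogonal to s. *)
Lemma rank2_orthogonal s t : rank2 -> g s s != 0 -> g t t != 0 -> g s t = 0 ->
  forall w w', g w s = 0 -> g w' t = 0 -> g w w' = 0.
Proof.
move=> r2 ss tt st w w' ws w't.
rewrite (rank2_coords r2 ss tt st w) ws mul0r scale0r add0r formZl.
by rewrite (gsym t) w't mulr0.
Qed.

End Rank2.

Lemma TM_stdv (R : realType) (M : oriented_surface R) (x : M) (w : TM x) :
  w = (w : 'rV[R]_2) 0 0 *: (stdv 0 : TM x)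
    + (w : 'rV[R]_2) 0 1 *: (stdv 1 : TM x).
Proof.
rewrite [LHS](row_sum_delta (w : 'rV[R]_2)) !big_ord_recl big_ord0 addr0.
by congr (_ + (w : 'rV[R]_2) 0 _ *: stdv _); apply/val_inj.
Qed.

Lemma rank2_TM (R : realType) (M : oriented_surface R) (x : M) :
  rank2 (V := TM x).
Proof. by exists (stdv 0), (stdv 1) => w; do 2 eexists; exact: TM_stdv. Qed.

Lemma rank2_fib (R : realType) (M : oriented_surface R) (E : rank2_bundle M)
  (x : M) : rank2 (V := E x).
Proof.
have [t tt tx] := triv_cover E x.
exists (t.2 0 x), (t.2 1 x) => w.
have [a [-> _]] := triv_basis tt tx w.
exists (a 0 0), (a 0 1); rewrite !big_ord_recl big_ord0 addr0.
by congr (_ + a 0 _ *: t.2 _ x); apply/val_inj.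
Qed.

Section Curvature.
Context {R : realType} {M : oriented_surface R} {V : M -> lmodType R}.
Context (sm : set M -> (forall x, V x) -> Prop) (g : forall x, V x -> V x -> R)
  (nabla : (forall x, V x) -> forall x : M, TM x -> V x)
  (gmet : is_metric sm g) (con : is_connection sm nabla)
  (comp : metric_compatible sm g nabla) (r2 : forall x, rank2 (V := V x)).
Context (U : set M) (oU : open U) (s t : forall x, V x) (cs ct : R)
  (sms : sm U s) (smt : sm U t) (cs0 : cs != 0) (ct0 : ct != 0)
  (gss : forall x, U x -> g (s x) (s x) = cs)
  (gtt : forall x, U x -> g (t x) (t x) = ct)
  (gst : forall x, U x -> g (s x) (t x) = 0).

Let near_sm x r : U x -> sm U r -> smooth_near sm x r.
Proof. by move=> Ux smr; exists U. Qed.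

Lemma metric_compat_cst r r' (c : R) x (v : TM x) : sm U r -> sm U r' ->
  (forall y, U y -> g (r y) (r' y) = c) -> U x ->
  g (nabla r v) (r' x) + g (r x) (nabla r' v) = 0.
Proof.
move=> sr sr' gc Ux; rewrite -(comp (near_sm Ux sr) (near_sm Ux sr')).
by rewrite (eq_dfun _ oU Ux gc) dfun_cst.
Qed.

Lemma metric_nabla_self r (c : R) x (v : TM x) : sm U r ->
  (forall y, U y -> g (r y) (r y) = c) -> U x -> g (nabla r v) (r x) = 0.
Proof.
move=> sr gc Ux; have := metric_compat_cst v sr sr gc Ux.
rewrite (Defs.metric_sym gmet (r x)) -mulr2n => /eqP.
by rewrite mulrn_eq0 => /eqP.
Qed.

Lemma metric_nabla_anti x (v : TM x) : U x ->
  g (nabla t v) (s x) = - g (nabla s v) (t x).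
Proof.
move=> Ux; have /eqP := metric_compat_cst v sms smt gst Ux.
by rewrite addrC addr_eq0 (Defs.metric_sym gmet) => /eqP.
Qed.

(** The Leibniz rule for the metric yields the exterior derivative of the
    connection form g(nabla s, t) and a term g(nabla s, nabla t). The latter
    vanishes because s and t have constant length and rank 2 leaves no room:
    nabla s is a multiple of t and nabla t is one of s. *)
Lemma curvature_form (X Y : forall x : M, TM x) x :
  smooth_vf U X -> smooth_vf U Y -> U x ->
  g (curvature nabla X Y s x) (t x)
  = dfun (fun y => g (nabla s (Y y)) (t y)) (X x)
    - dfun (fun y => g (nabla s (X y)) (t y)) (Y x)
    - g (nabla s (lie_bracket X Y x)) (t x).
Proof.
move=> sX sY Ux.
have orth (v w : TM x) : g (nabla s v) (nabla t w) = 0.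
  apply: (rank2_orthogonal (metric_linear gmet (x := x))
    (Defs.metric_sym gmet (x := x)) (r2 x) (s := s x) (t := t x)).
  - by rewrite gss.
  - by rewrite gtt.
  - exact: gst.
  - exact: metric_nabla_self gss Ux.
  - exact: metric_nabla_self gtt Ux.
have sYs := conn_smooth con oU sms sY; have sXs := conn_smooth con oU sms sX.
rewrite (comp (near_sm Ux sYs) (near_sm Ux smt)).
rewrite (comp (near_sm Ux sXs) (near_sm Ux smt)).
rewrite !orth !addr0 /curvature.
have gl := metric_linear gmet (x := x).
by rewrite !(formDl gl) !(formNl gl).
Qed.

End Curvature.

(** * The area form of a frame *)

Section Area.
Context {R : realType} {M : oriented_surface R}.
Context (g : forall x : M, TM x -> TM x -> R) (gmet : is_metric smooth_vf g).

Lemma det_mx22 (A : 'M[R]_2) : \det A = A 0 0 * A 1 1 - A 0 1 * A 1 0.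
Proof.
rewrite (expand_det_row _ 0) !big_ord_recl big_ord0 /cofactor !det_mx11 !mxE /=.
rewrite /= !addn0 expr0 expr1 mul1r addr0 mulN1r mulrN.
by congr (A _ _ * A _ _ - A _ _ * A _ _); apply/val_inj.
Qed.

Lemma area_formE (x : M) (X Y : TM x) : area_form g X Y =
  Num.sqrt (g (stdv 0 : TM x) (stdv 0) * g (stdv 1 : TM x) (stdv 1)
            - g (stdv 0 : TM x) (stdv 1) * g (stdv 0 : TM x) (stdv 1))
  * ((X : 'rV[R]_2) 0 0 * (Y : 'rV[R]_2) 0 1
     - (X : 'rV[R]_2) 0 1 * (Y : 'rV[R]_2) 0 0).
Proof.
rewrite /area_form !det_mx22 !mxE /=.
by rewrite [g (stdv 1 : TM x) (stdv 0)](Defs.metric_sym gmet).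
Qed.

Lemma area_form_bilinear (x : M) (u v : TM x) (a b c d : R) :
  area_form g (a *: u + b *: v) (c *: u + d *: v)
  = (a * d - b * c) * area_form g u v.
Proof. rewrite !area_formE !mxE; ring. Qed.

(** The Gram determinant of (u, v) is the determinant of g times the square
    of the determinant of (u, v), and the latter is positive. *)
Lemma area_form_frame (x : M) (u v : TM x) : frameM g u v -> area_form g u v = 1.
Proof.
case=> uu vv uv pos.
have gl := metric_linear gmet (x := x).
have gs := Defs.metric_sym gmet (x := x).
pose a := g (stdv 0 : TM x) (stdv 0); pose b := g (stdv 0 : TM x) (stdv 1).
pose c := g (stdv 1 : TM x) (stdv 1).
have gE (w z : TM x) : g w z
    = (w : 'rV[R]_2) 0 0 * ((z : 'rV[R]_2) 0 0 * a + (z : 'rV[R]_2) 0 1 * b)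
    + (w : 'rV[R]_2) 0 1 * ((z : 'rV[R]_2) 0 0 * b + (z : 'rV[R]_2) 0 1 * c).
  rewrite [in LHS](TM_stdv w) (formDl gl) !(formZl gl) !(gs _ z).
  rewrite [in LHS](TM_stdv z).
  rewrite !(formDl gl) !(formZl gl) /a /b /c.
  by rewrite (gs (stdv 1) (stdv 0)).
rewrite area_formE -/a -/b -/c; move: uu vv uv pos; rewrite !gE.
rewrite /positive_basis det_mx22 !mxE /=.
move: ((u : 'rV[R]_2) 0 0) ((u : 'rV[R]_2) 0 1) => u0 u1.
move: ((v : 'rV[R]_2) 0 0) ((v : 'rV[R]_2) 0 1) => v0 v1.
move=> uu vv uv pos; clearbody a b c.
set D := u0 * v1 - u1 * v0 in pos *.
have D0 : D != 0 by exact: lt0r_neq0.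
(* (ac - b^2) D^2 is the Gram determinant of (u, v), which is 1. *)
have -> : a * c - b * b = D^-1 ^+ 2.
  apply: (mulIf (expf_neq0 2 D0)); rewrite -exprMn mulVf// expr1n.
  transitivity ((u0 * (u0 * a + u1 * b) + u1 * (u0 * b + u1 * c))
     * (v0 * (v0 * a + v1 * b) + v1 * (v0 * b + v1 * c))
    - (u0 * (v0 * a + v1 * b) + u1 * (v0 * b + v1 * c)) ^+ 2).
    by rewrite /D; ring.
  by rewrite uu vv uv; ring.
by rewrite sqrtr_sqr gtr0_norm ?invr_gt0// mulVf.
Qed.

End Area.

(** * The Gauss map of an immersion given by a spinor *)

Section Frames.
Local Open Scope cquat_scope.
Context {R : realType} {M : oriented_surface R}
    (gM : forall x : M, TM x -> TM x -> R)
    (nablaM : (forall x : M, TM x) -> forall x : M, TM x -> TM x)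
    (E : rank2_bundle M) (gE : forall x, E x -> E x -> R)
    (nablaE : (forall x, E x) -> forall x : M, TM x -> E x)
    (future rightward : forall x, set (E x))
    (S1 : spinE gE future rightward) (S2 : spinM gM)
    (Hv : forall x, E x)
    (phi : forall x, S1 x -> S2 x -> 'rV[R[i]]_4)
    (F G : M -> 'rV[R[i]]_4) (K KN : M -> R)
    (gM_met : is_metric smooth_vf gM)
    (nablaM_conn : is_connection smooth_vf nablaM)
    (nablaM_metric : metric_compatible smooth_vf gM nablaM)
    (gE_met : is_metric (smooth_section (E:=E)) gE)
    (nablaE_conn : is_connection (smooth_section (E:=E)) nablaE)
    (nablaE_metric : metric_compatible (smooth_section (E:=E)) gE nablaE)
    (phi_spinor : spinor_field phi)
    (phi_dirac : dirac_equation nablaE nablaM Hv phi)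
    (phi_norm : forall x p1 p2, qH (phi x p1 p2) (phi x p1 p2) = 1)
    (F_phi : immersion_given_by phi F)
    (G_gauss : gauss_map F G)
    (K_gauss : gauss_curvature gM nablaM K)
    (KN_curv : bundle_curvature gM gE future rightward nablaE KN).

Lemma vcoord_fr0E x (p1 : S1 x) (p2 : S2 x) :
  vcoord p1 p2 (spin_fr0 p1) 0 = 'i *: qone.
Proof.
have [e00 e11 e01 _ _] := spin_frame p1.
rewrite /vcoord !(form0l (metric_linear gM_met (x := x))) e00 e01 opprK.
exact: mink_one.
Qed.

Lemma vcoord_fr1E x (p1 : S1 x) (p2 : S2 x) :
  vcoord p1 p2 (spin_fr1 p1) 0 = qI.
Proof.
have [e00 e11 e01 _ _] := spin_frame p1.
rewrite /vcoord !(form0l (metric_linear gM_met (x := x))).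
by rewrite (Defs.metric_sym gE_met) e11 e01 oppr0 mink_I.
Qed.

Lemma vcoord_fr0M x (p1 : S1 x) (p2 : S2 x) :
  vcoord p1 p2 0 (spin_fr0 p2) = qJ.
Proof.
have [e22 e33 e23 _] := spin_frame p2.
rewrite /vcoord !(form0l (metric_linear gE_met (x := x))) e22 e23 oppr0.
exact: mink_J.
Qed.

Lemma vcoord_fr1M x (p1 : S1 x) (p2 : S2 x) :
  vcoord p1 p2 0 (spin_fr1 p2) = qK.
Proof.
have [e22 e33 e23 _] := spin_frame p2.
rewrite /vcoord !(form0l (metric_linear gE_met (x := x))).
by rewrite (Defs.metric_sym gM_met) e33 e23 oppr0 mink_K.
Qed.

Context (t1 : set M * (forall x, S1 x)) (t2 : set M * (forall x, S2 x))
  (t1P : spin_loc t1) (t2P : spin_loc t2).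

Local Notation U := (t1.1 `&` t2.1).
Local Notation e0 := (fun y => spin_fr0 (t1.2 y)).
Local Notation e1 := (fun y => spin_fr1 (t1.2 y)).
Local Notation e2 := (fun y => spin_fr0 (t2.2 y)).
Local Notation e3 := (fun y => spin_fr1 (t2.2 y)).
Local Notation psi := (fun y => phi (t1.2 y) (t2.2 y)).

(** The complex connection form eta of the spinor bundle: since
    e0 . e1 and e2 . e3 act by left multiplication by i I and I,
    the coordinate of nabla phi is dpsi + eta I psi. *)
Definition spin_form (x : M) (v : TM x) : R[i] :=
  (gM (nablaM e2 v) (spin_fr1 (t2.2 x)) / 2)
  +i* (- gE (nablaE e0 v) (spin_fr1 (t1.2 x)) / 2).

Lemma spin_nablaE x (v : TM x) :
  spin_nabla nablaE nablaM phi t1.2 t2.2 v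
  = dq psi v + spin_form v *: (qI ** phi (t1.2 x) (t2.2 x)).
Proof.
rewrite /spin_nabla /clifford vcoord_fr0E vcoord_fr1E vcoord_fr0M vcoord_fr1M.
rewrite !qhatM !qhatK qhat_I qhat_K [qJ ** _]qmulA qmulJK.
rewrite qmulZl qmul1q -addrA scalerA -scalerDl; congr (_ + _ *: _).
by apply/eqP; rewrite eq_complex; apply/andP; split; apply/eqP => /=; ring.
Qed.

Let oU : open U.
Proof. by apply: openI; exact: spin_loc_open. Qed.

Let spsi : smooth_q U psi.
Proof. exact: phi_spinor.2. Qed.

Let se0 : smooth_section U e0.
Proof.
by apply: smooth_section_sub (spin_loc_frame t1P).1; exact: subIsetl.
Qed.
Let se1 : smooth_section U e1.
Proof.
by apply: smooth_section_sub (spin_loc_frame t1P).2; exact: subIsetl.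
Qed.
Let se2 : smooth_vf U e2.
Proof.
by apply: smooth_vf_sub (spin_loc_frame t2P).1; exact: subIsetr.
Qed.
Let se3 : smooth_vf U e3.
Proof.
by apply: smooth_vf_sub (spin_loc_frame t2P).2; exact: subIsetr.
Qed.

Let dpsi_I x (v : TM x) := q1 (dq psi v ** qbar (phi (t1.2 x) (t2.2 x))).

Lemma qH_dpsi x (v : TM x) : U x -> qH (dq psi v) (phi (t1.2 x) (t2.2 x)) = 0.
Proof. by move=> Ux; apply: qH_dq_eq0 oU spsi _ Ux => y _; exact: phi_norm. Qed.

Lemma dpsi_I_frame x : U x ->
  dpsi_I (spin_fr0 (t2.2 x)) = - spin_form (spin_fr0 (t2.2 x)) /\
  dpsi_I (spin_fr1 (t2.2 x)) = - spin_form (spin_fr1 (t2.2 x)).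
Proof.
move=> Ux; have := phi_dirac t1P t2P Ux.
rewrite /= !spin_nablaE /clifford vcoord_fr0M vcoord_fr1M.
apply: dirac_components; [exact: phi_norm|exact: qH_dpsi..| |];
  by rewrite /vcoord /mink quatE !(form0l (metric_linear gM_met (x := x))).
Qed.

Lemma spin_form_linear x (a : R) (v w : TM x) : U x ->
  spin_form (a *: v + w) = a%:C * spin_form v + spin_form w.
Proof.
move=> Ux.
have nM : smooth_near smooth_vf x e2 by exists U.
have nE : smooth_near (smooth_section (E:=E)) x e0 by exists U.
rewrite /spin_form (conn_linear nablaM_conn nM) (conn_linear nablaE_conn nE).
rewrite (metric_linear gM_met) (metric_linear gE_met).
by apply/eqP; rewrite eq_complex; apply/andP; split; apply/eqP => /=; ring.
Qed.

Lemma frame_coords x (v : TM x) :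
  v = gM v (spin_fr0 (t2.2 x)) *: spin_fr0 (t2.2 x)
    + gM v (spin_fr1 (t2.2 x)) *: spin_fr1 (t2.2 x).
Proof.
have [e22 e33 e23 _] := spin_frame (t2.2 x).
rewrite {1}(rank2_coords (metric_linear gM_met (x := x))
  (Defs.metric_sym gM_met (x := x)) (rank2_TM x) _ _ e23 v) ?e22 ?e33 ?oner_eq0//.
by rewrite !divr1.
Qed.

Lemma dpsi_I_spin_form x (v : TM x) : U x -> dpsi_I v = - spin_form v.
Proof.
move=> Ux.
have lin a (u w : TM x) : dpsi_I u = - spin_form u -> dpsi_I w = - spin_form w ->
    dpsi_I (a *: u + w) = - spin_form (a *: u + w).
  move=> eu ew; rewrite spin_form_linear// opprD -mulrN -eu -ew.
  by rewrite /dpsi_I (dq_linear a u w oU spsi Ux) qmulDl qmulZl q1D q1Z.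
have [a2 a3] := dpsi_I_frame Ux.
have z : dpsi_I (0 : TM x) = - spin_form (0 : TM x).
  have := spin_form_linear (-1) (0 : TM x) 0 Ux.
  rewrite scaler0 addr0 rmorphN1 mulN1r addNr => ->; rewrite oppr0.
  have := dq_linear (-1) (0 : TM x) 0 oU spsi Ux.
  rewrite scaler0 addr0 rmorphN1 scaleN1r addNr /dpsi_I => ->.
  by rewrite /qmul !quatE; ring.
rewrite (frame_coords v) -[X in _ + X]addr0.
by apply: (lin) => //; apply: lin.
Qed.

(** Both curvatures are exterior derivatives of connection forms, and these
    are the real and imaginary parts of theta = - 2 eta = 2 alpha1. *)
Lemma curvature_spinor x : U x ->
  let A := dq psi (spin_fr0 (t2.2 x)) in let B := dq psi (spin_fr1 (t2.2 x)) in
  K x +i* KN x = 2 * (q1 (B ** qbar A) - q1 (A ** qbar B)).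
Proof.
move=> Ux A B.
have fM y : U y -> frameM gM (e2 y) (e3 y) by move=> _; exact: spin_frame.
have fE y : U y -> frameE gE future rightward (e0 y) (e1 y).
  by move=> _; exact: spin_frame.
have g22 y : U y -> gM (e2 y) (e2 y) = 1 by move=> /fM[].
have g33 y : U y -> gM (e3 y) (e3 y) = 1 by move=> /fM[].
have g23 y : U y -> gM (e2 y) (e3 y) = 0 by move=> /fM[].
have g32 y : U y -> gM (e3 y) (e2 y) = 0.
  by move=> /g23 <-; exact: Defs.metric_sym gM_met _ _ _.
have g00 y : U y -> gE (e0 y) (e0 y) = -1 by move=> /fE[].
have g11 y : U y -> gE (e1 y) (e1 y) = 1 by move=> /fE[].
have g01 y : U y -> gE (e0 y) (e1 y) = 0 by move=> /fE[].
have n1 : (1 : R) != 0 by exact: oner_neq0.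
have nN1 : (-1 : R) != 0 by rewrite oppr_eq0.
rewrite (K_gauss oU se2 se3 fM Ux) (KN_curv oU se0 se1 se2 se3 fE fM Ux).
rewrite (curvature_form gM_met nablaM_conn nablaM_metric (@rank2_TM R M)
  oU se3 se2 n1 n1 g33 g22 g32 se2 se3 Ux).
rewrite (curvature_form gE_met nablaE_conn nablaE_metric (rank2_fib E)
  oU se0 se1 nN1 n1 g00 g11 g01 se2 se3 Ux).
pose theta y (v : TM y) := gM (nablaM e3 v) (e2 y) +i* gE (nablaE e0 v) (e1 y).
have thetaE y (v : TM y) : U y -> theta y v = dpsi_I v + dpsi_I v.
  move=> Uy; rewrite dpsi_I_spin_form// /theta /spin_form.
  rewrite (metric_nabla_anti gM_met nablaM_metric oU se2 se3 g23 v Uy).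
  by apply/eqP; rewrite eq_complex; apply/andP; split; apply/eqP => /=; field.
have [a [b [da db E1]]] := maurer_cartan_I oU spsi se2 se3 Ux.
transitivity (dc (fun y => theta y (e3 y)) (e2 x)
  - dc (fun y => theta y (e2 y)) (e3 x) - theta x (lie_bracket e2 e3 x)).
  by [].
have [_ _ daa] := is_dcD da da; have [_ _ dbb] := is_dcD db db.
rewrite (eq_dc _ oU Ux (fun y Uy => thetaE y (e3 y) Uy)).
rewrite (eq_dc _ oU Ux (fun y Uy => thetaE y (e2 y) Uy)).
rewrite daa dbb thetaE// -E1 /dpsi_I.
ring.
Qed.

(** From qhat psi qbar (qhat psi) = 1 one gets
    dF(e2) qhat (dF(e3)) = qbar psi J K psi, and J K = I. *)
Lemma gauss_map_spinor x (p1 : S1 x) (p2 : S2 x) :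
  G x = qbar (phi p1 p2) ** qI ** phi p1 p2.
Proof.
have [_ _ iso dF] := F_phi.
have [e22 e33 e23 pos] := spin_frame p2.
rewrite (G_gauss pos) ?iso ?e22 ?e33 ?e23//.
rewrite !(dF _ p1 p2) /pairing /clifford vcoord_fr0M vcoord_fr1M.
set q := phi p1 p2; have n1 : qH q q = 1 by exact: phi_norm.
clearbody q.
have nh : qhat q ** qbar (qhat q) = qone.
  rewrite -qhat_bar -qhatM qmul_bar n1 scale1r.
  exact: qhat_one.
have P (u w : 'rV[R[i]]_4) : qhat w = w ->
    qbar q ** (u ** qhat q) ** qhat (qbar q ** (w ** qhat q))
    = qbar q ** (u ** w) ** q.
  move=> hw; rewrite !qhatM hw qhatK qhat_bar -!qmulA; congr (_ ** (_ ** _)).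
  by rewrite [qhat q ** _]qmulA nh qmul1q.
rewrite /wedge (P _ _ qhat_K) (P _ _ qhat_J) qmulJK qmulKJ qmulNr qmulNl opprK.
rewrite scalerDr -scalerDl.
have -> : 2^-1 + 2^-1 = 1 :> R[i] by field.
exact: scale1r.
Qed.

Lemma dq_gauss x (v : TM x) : U x ->
  dq G v = dgauss (phi (t1.2 x) (t2.2 x)) (dq psi v).
Proof.
move=> Ux.
rewrite (eq_dq v oU Ux (fun y _ => gauss_map_spinor (t1.2 y) (t2.2 y))).
have h := is_dq_smooth v oU spsi Ux.
rewrite (is_dqE (is_dq_mul (is_dq_mul (is_dq_bar h) (is_dq_cst qI v)) h)).
have q0r (p : 'rV[R[i]]_4) : p ** 0 = 0.
  by apply: quatP; rewrite /qmul !quatE; ring.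
by rewrite q0r addr0.
Qed.

Lemma dq_gauss_coords x (v : TM x) : U x ->
  dq G v = (gM v (spin_fr0 (t2.2 x)))%:C *: dq G (spin_fr0 (t2.2 x))
         + (gM v (spin_fr1 (t2.2 x)))%:C *: dq G (spin_fr1 (t2.2 x)).
Proof.
move=> Ux; rewrite {1}(frame_coords v).
have lin a (u w : TM x) : dq G (a *: u + w) = a%:C *: dq G u + dq G w.
  by rewrite !dq_gauss// (dq_linear a u w oU spsi Ux) dgauss_linear.
have z : dq G (0 : TM x) = 0.
  by have := lin (-1) 0 0; rewrite scaler0 addr0 rmorphN1 scaleN1r addNr.
have linZ a (u : TM x) : dq G (a *: u) = a%:C *: dq G u.
  by have := lin a u 0; rewrite addr0 z addr0.
by rewrite lin linZ.
Qed.

Lemma gauss_pullback x (X Y : TM x) : U x ->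
  omegaQ (G x) (dq G X) (dq G Y) = (K x +i* KN x) * (area_form gM X Y)%:C.
Proof.
move=> Ux.
rewrite [area_form gM X Y](_ : _ =
    gM X (spin_fr0 (t2.2 x)) * gM Y (spin_fr1 (t2.2 x))
    - gM X (spin_fr1 (t2.2 x)) * gM Y (spin_fr0 (t2.2 x))); last first.
  rewrite [in LHS](frame_coords X) [in LHS](frame_coords Y).
  rewrite (area_form_bilinear gM_met).
  by rewrite (area_form_frame gM_met (spin_frame (t2.2 x))) mulr1.
rewrite (dq_gauss_coords X Ux) (dq_gauss_coords Y Ux) omegaQ_bilinear.
rewrite (gauss_map_spinor (t1.2 x) (t2.2 x)) !dq_gauss// omegaQ_dgauss//.
  rewrite curvature_spinor// mulrC; congr (_ * _).
  by apply/eqP; rewrite eq_complex; apply/andP; split; apply/eqP => /=; ring.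
all: by rewrite ?qH_dpsi.
Qed.

(** The image of dG is spanned by dG(e2) and dG(e3), on which the pulled back
    area form takes the value K + i K_N. *)
Lemma flat_iff_complex_line x : U x ->
  (K x = 0 /\ KN x = 0) <->
  exists L : {vspace 'rV[R[i]]_4},
    [/\ \dim L = 1%N, [set` L] `<=` tangentQ (G x)
      & forall X : TM x, dq G X \in L].
Proof.
move=> Ux.
have tG (v : TM x) : tangentQ (G x) (dq G v).
  rewrite (gauss_map_spinor (t1.2 x) (t2.2 x)) dq_gauss//.
  by apply: tangentQ_dgauss; [exact: phi_norm|exact: qH_dpsi].
have G0 : q0 (G x) = 0.
  by rewrite (gauss_map_spinor (t1.2 x) (t2.2 x)) /qmul /qbar /qI !quatE; ring.
have G1 : qH (G x) (G x) = 1.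
  rewrite (gauss_map_spinor (t1.2 x) (t2.2 x)) qH_conj//.
  by rewrite /qH /qI !quatE; ring.
have KE : (K x = 0 /\ KN x = 0) <->
    omegaQ (G x) (dq G (spin_fr0 (t2.2 x))) (dq G (spin_fr1 (t2.2 x))) = 0.
  rewrite gauss_pullback// (area_form_frame gM_met (spin_frame (t2.2 x))) mulr1.
  by split=> [[-> ->]//|[-> ->]].
rewrite KE omegaQ_eq0_line//; split=> [[L [dL sL L2 L3]]|[L [dL sL Lv]]].
  exists L; split=> // X; rewrite (dq_gauss_coords X Ux).
  by rewrite memvD// memvZ.
by exists L.
Qed.

End Frames.

Theorem proposition6p3 (R : realType) (M : oriented_surface R)
    (gM : forall x : M, TM x -> TM x -> R)
    (nablaM : (forall x : M, TM x) -> forall x : M, TM x -> TM x)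
    (E : rank2_bundle M) (gE : forall x, E x -> E x -> R)
    (nablaE : (forall x, E x) -> forall x : M, TM x -> E x)
    (future rightward : forall x, set (E x))
    (S1 : spinE gE future rightward) (S2 : spinM gM)
    (Hv : forall x, E x)
    (phi : forall x, S1 x -> S2 x -> 'rV[R[i]]_4)
    (F G : M -> 'rV[R[i]]_4) (K KN : M -> R)
    (gM_riem : riemannian gM) (nablaM_lc : levi_civita gM nablaM)
    (gE_sign : signature11 gE)
    (nablaE_conn : is_connection (smooth_section (E:=E)) nablaE)
    (nablaE_metric : metric_compatible (smooth_section (E:=E)) gE nablaE)
    (E_time : cone_orientation (fun x u v => - gE x u v) future)
    (E_space : cone_orientation gE rightward)
    (Hv_smooth : smooth_section setT Hv)
    (phi_spinor : spinor_field phi)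
    (phi_dirac : dirac_equation nablaE nablaM Hv phi)
    (phi_norm : forall x p1 p2, qH (phi x p1 p2) (phi x p1 p2) = 1)
    (F_phi : immersion_given_by phi F)
    (G_gauss : gauss_map F G)
    (K_gauss : gauss_curvature gM nablaM K)
    (KN_curv : bundle_curvature gM gE future rightward nablaE KN) :
  (forall (x : M) (X Y : TM x),
     omegaQ (G x) (dq G X) (dq G Y)
     = (K x +i* KN x) * (area_form gM X Y)%:C) /\
  (forall x : M,
     (K x = 0 /\ KN x = 0) <->
     exists L : {vspace 'rV[R[i]]_4},
       [/\ \dim L = 1%N, [set` L] `<=` tangentQ (G x)
         & forall X : TM x, dq G X \in L]).
Proof.
have [gM_met _] := gM_riem; have [gE_met _] := gE_sign.
have [nM_conn nM_metric _] := nablaM_lc.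
split=> x; have [t1 t1P t1x] := spin_loc_cover S1 x;
  have [t2 t2P t2x] := spin_loc_cover S2 x; have Ux := conj t1x t2x.
  move=> X Y.
  exact: (gauss_pullback gM_met nM_conn nM_metric gE_met nablaE_conn
    nablaE_metric phi_spinor phi_dirac phi_norm F_phi G_gauss K_gauss KN_curv
    t1P t2P X Y Ux).
exact: (flat_iff_complex_line gM_met nM_conn nM_metric gE_met nablaE_conn
  nablaE_metric phi_spinor phi_dirac phi_norm F_phi G_gauss K_gauss KN_curv
  t1P t2P Ux).
Qed.
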